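(* Let $T>0$, let $n,d\ge1$ be integers, let $f\in C_b^2(\mathbb{R}^n;\mathcal{L}(\mathbb{R}^d;\mathbb{R}^n))$, and let $q\in[1,2)$ and $p\in[q,\infty)$ satisfy $1/p+1/q>1$. Let $y,\tilde y\in\mathbb{R}^n$, $A,\tilde A\in D^q([0,T];\mathbb{R}^d)$ and $X,\tilde X,L,\tilde L\in D^p([0,T];\mathbb{R}^n)$ be such that $y\ge L_0$ and $\tilde y\ge\tilde L_0$ (componentwise). Let $(Y,K)$ and $(\tilde Y,\tilde K)$ be the unique solutions of the reflected Young differential equation $$Y_t=y+\int_0^t f(Y_s)\,\mathrm{d}A_s+X_t+K_t,\qquad t\in[0,T],$$ corresponding to the data $(y,A,X,L)$ and $(\tilde y,\tilde A,\tilde X,\tilde L)$ respectively. Suppose that the norms $\|A\|_{q,[0,T]}$, $\|\tilde A\|_{q,[0,T]}$, $\|X\|_{p,[0,T]}$, $\|\tilde X\|_{p,[0,T]}$, $\|L\|_{p,[0,T]}$ and $\|\tilde L\|_{p,[0,T]}$ are all bounded by a given constant $M>0$. Then $$\sigma_{p,[0,T]}\big((Y,K),(\tilde Y,\tilde K)\big)\le C_{M,f}\Big(|y-\tilde y|+|L_0-\tilde L_0|+\hat\sigma_{p,q,[0,T]}\big((A,X,L),(\tilde A,\tilde X,\tilde L)\big)\Big)$$ for some constant $C_{M,f}$ depending on $M$, $\|f\|_{C_b^2}$, $p$, $q$ and $n$.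
   Context: For $r\ge1$, $D^r([0,T];\mathbb{R}^m)$ denotes the space of càdlàg (right-continuous with left limits) paths $Z:[0,T]\to\mathbb{R}^m$ with finite $r$-variation $\|Z\|_{r,[0,T]}<\infty$, where $\|Z\|_{r,[s,t]}:=\big(\sup_{\mathcal{P}}\sum_{[u,v]\in\mathcal{P}}|Z_v-Z_u|^r\big)^{1/r}$, the supremum being over all finite partitions $\mathcal{P}$ of $[s,t]$, and $|\cdot|$ is the Euclidean norm. $\mathcal{L}(\mathbb{R}^d;\mathbb{R}^n)$ is the space of linear maps $\mathbb{R}^d\to\mathbb{R}^n$. $C_b^k(\mathbb{R}^n;\mathcal{L}(\mathbb{R}^d;\mathbb{R}^n))$ is the space of $k$-times Fréchet differentiable functions which, together with all derivatives up to order $k$, are continuous and bounded, with norm $\|f\|_{C_b^k}:=\|f\|_\infty+\|\mathrm{D}f\|_\infty+\dots+\|\mathrm{D}^kf\|_\infty$. Young integral: for a càdlàg path $H$ of finite $p$-variation with values in $\mathcal{L}(\mathbb{R}^d;\mathbb{R}^n)$ and $A\in D^q([0,T];\mathbb{R}^d)$ with $1/p+1/q>1$, $\int_s^tH_r\,\mathrm{d}A_r:=\lim_{|\mathcal{P}|\to0}\sum_{[u,v]\in\mathcal{P}}H_u(A_v-A_u)$ (left-point Riemann sums, limit over partitions of $[s,t]$ with mesh tending to $0$). Solution: a pair $(Y,K)$ is a solution of the reflected Young differential equation with data $(y,A,X,L)$ if $Y,K\in D^p([0,T];\mathbb{R}^n)$ satisfy the displayed equation for all $t\in[0,T]$ and,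 for every $i=1,\dots,n$: (a) $Y^i_t\ge L^i_t$ for all $t\in[0,T]$; (b) $K^i:[0,T]\to\mathbb{R}$ is a non-decreasing function with $K^i_0=0$ and $\int_0^t(Y^i_s-L^i_s)\,\mathrm{d}K^i_s=0$ for all $t\in[0,T]$, where this last integral is a Lebesgue–Stieltjes integral. Skorokhod $J_1$ $p$-variation distances: let $\Lambda$ be the set of all increasing bijective functions $\lambda:[0,T]\to[0,T]$ and $\|\lambda\|:=\sup_{t\in[0,T]}|\lambda(t)-t|$. Then $$\sigma_{p,[0,T]}((Y,K),(\tilde Y,\tilde K)):=\inf_{\lambda\in\Lambda}\Big(\|\lambda\|\vee\big(\|Y\circ\lambda-\tilde Y\|_{p,[0,T]}+\|K\circ\lambda-\tilde K\|_{p,[0,T]}\big)\Big),$$ $$\hat\sigma_{p,q,[0,T]}((A,X,L),(\tilde A,\tilde X,\tilde L)):=\inf_{\lambda\in\Lambda}\Big(\|\lambda\|\vee\big(\|A\circ\lambda-\tilde A\|_{q,[0,T]}+\|X\circ\lambda-\tilde X\|_{p,[0,T]}+\|L\circ\lambda-\tilde L\|_{p,[0,T]}\big)\Big),$$ where $a\vee b=\max\{a,b\}$. Convention: constants may in addition depend on the dimensions of the underlying spaces.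
   Formalization: The formal theorem adds the hypothesis X_0 = X̃_0 (e.g. both zero): since Y_0 = y + X_0 and the p-variation distances do not see initial values, the estimate fails without it (f = sin, A = Ã = id, y = ỹ = 0, L = L̃ = −100, X ≡ 1, X̃ ≡ 0). *)

(* Defs.v *)
From HB Require Import structures.
From mathcomp Require Import all_boot all_order all_algebra.
From mathcomp Require Import all_classical all_reals all_analysis.
Import Order.TTheory GRing.Theory Num.Theory.
Import numFieldNormedType.Exports.

Set Implicit Arguments.
Unset Strict Implicit.
Unset Printing Implicit Defensive.

Local Open Scope classical_set_scope.
Local Open Scope ring_scope.

(* Conventions: R^m is 'rV[R]_m, and a linear map R^d -> R^n is a matrix
   H : 'M[R]_(d, n) acting on row vectors by v |-> v *m H.  A path on [0, T] is
   a function R -> 'rV[R]_m; every notion below depends only on its values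
   on [0, T]. *)

Section Norms.
Context {R : realType}.
Implicit Types n m d : nat.

(* The norm `|v| of the library on 'rV[R]_m is the sup norm. *)
Definition enorm m (v : 'rV[R]_m) : R := Num.sqrt (\sum_i v 0 i ^+ 2).

Definition opnorm d n (H : 'M[R]_(d, n)) : \bar R :=
  ereal_sup [set (enorm (v *m H))%:E | v in [set v | enorm v <= 1]].

(* L(R^m; L(R^d; R^n)) is 'M_(m, d * n), where B sends u to vec_mx (u *m B);
   similarly L(R^m; L(R^m; L(R^d; R^n))) is 'M_(m, m * (d * n)). *)
Definition opnorm1 m d n (B : 'M[R]_(m, d * n)) : \bar R :=
  ereal_sup [set opnorm (vec_mx (u *m B)) | u in [set u | enorm u <= 1]].

Definition opnorm2 m d n (C : 'M[R]_(m, m * (d * n))) : \bar R :=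
  ereal_sup [set opnorm1 (vec_mx (u *m C)) | u in [set u | enorm u <= 1]].

Definition Fderiv m d n (f : 'rV[R]_m -> 'M[R]_(d, n)) (x : 'rV[R]_m) :
    'M[R]_(m, d * n) :=
  lin1_mx (mxvec \o 'd f x).

Lemma FderivE m d n (f : 'rV[R]_m -> 'M[R]_(d, n)) (x u : 'rV[R]_m) :
  vec_mx (u *m Fderiv f x) = 'd f x u.
Proof. by rewrite /Fderiv mul_rV_lin1 /= mxvecK. Qed.

Definition C2norm m d n (f : 'rV[R]_m -> 'M[R]_(d, n)) : \bar R :=
  (ereal_sup [set opnorm (f x) | x in setT]
   + ereal_sup [set opnorm1 (Fderiv f x) | x in setT]
   + ereal_sup [set opnorm2 (Fderiv (Fderiv f) x) | x in setT])%E.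

Definition Cb2 m d n (f : 'rV[R]_m -> 'M[R]_(d, n)) : Prop :=
  [/\ (forall x, differentiable f x) /\ (forall x, differentiable (Fderiv f) x),
      continuous f, continuous (Fderiv f), continuous (Fderiv (Fderiv f))
    & (C2norm f < +oo)%E].

End Norms.

Section Paths.
Context {R : realType}.
Implicit Types (m : nat) (a b r T : R).

Definition cadlag m T (Z : R -> 'rV[R]_m) : Prop :=
  (forall t, 0 <= t < T -> Z @ t^'+ --> Z t) /\
  (forall t, 0 < t <= T -> cvg (Z @ t^'-)).

(* A partition a = s_0 < s_1 < ... < s_k = b is encoded, as in itv_partition,
   by the list s = [:: s_1; ...; s_k]. *)
Definition partition_sum (V : nmodType) (g : R -> R -> V) a (s : seq R) : V :=
  \sum_(i < size s) g (nth a (a :: s) i) (nth a (a :: s) i.+1).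

Definition mesh a (s : seq R) : R :=
  \big[Num.max/0]_(i < size s) (nth a (a :: s) i.+1 - nth a (a :: s) i).

Definition pvar m r a b (Z : R -> 'rV[R]_m) : \bar R :=
  (ereal_sup [set (partition_sum (fun u v => enorm (Z v - Z u) `^ r) a s)%:E
             | s in [set s | itv_partition a b s]] `^ r^-1)%E.

Definition Dpath m r T (Z : R -> 'rV[R]_m) : Prop :=
  cadlag T Z /\ (pvar r 0 T Z < +oo)%E.

Definition mesh_to_0 a b : set_system (seq R) :=
  filter_from [set e | 0 < e]
    (fun e => [set s | itv_partition a b s /\ mesh a s < e]).

Definition is_young_integral d n (H : R -> 'M[R]_(d, n)) (A : R -> 'rV[R]_d)
    a b (I : 'rV[R]_n) : Prop :=
  partition_sum (fun u v => (A v - A u) *m H u) a @ mesh_to_0 a b --> I.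

(* G is the constant extension of k outside [0, T]; its Lebesgue-Stieltjes
   measure has no atom at 0 and no mass outside [0, T]. *)
Definition extends_path T (k : R -> R) (G : R -> R) : Prop :=
  forall s, G s = k (Num.max 0 (Num.min s T)).

(* int_0^t g dk = 0 for all t in [0, T], for k non-decreasing and
   right-continuous on [0, T] *)
Definition LS_integral_eq0 T (k g : R -> R) : Prop :=
  exists2 G : cumulative R R, extends_path T k G &
    forall t, 0 <= t <= T ->
      (\int[lebesgue_stieltjes_measure G]_(s in [set` `]0%R, t]]) (g s)%:E = 0)%E.

Definition reflected_solution n d (f : 'rV[R]_n -> 'M[R]_(d, n)) (p T : R)
    (y : 'rV[R]_n) (A : R -> 'rV[R]_d) (X L Y K : R -> 'rV[R]_n) : Prop :=
  [/\ Dpath p T Y /\ Dpath p T K,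
      forall t, 0 <= t <= T -> exists2 I : 'rV[R]_n,
        is_young_integral (f \o Y) A 0 t I & Y t = y + I + X t + K t,
      forall i t, 0 <= t <= T -> L t 0 i <= Y t 0 i
    & forall i,
        [/\ forall s t, 0 <= s -> s <= t -> t <= T -> K s 0 i <= K t 0 i,
            K 0 0 i = 0
          & LS_integral_eq0 T (fun s => K s 0 i)
              (fun s => Y s 0 i - L s 0 i)]].

Definition time_change T (lam : R -> R) : Prop :=
  set_bij `[0, T] `[0, T] lam /\
  {in `[0, T] &, forall s t, s < t -> lam s < lam t}.

Definition time_change_norm T (lam : R -> R) : \bar R :=
  ereal_sup [set `|lam t - t|%:E | t in `[0, T]].

Definition sigma n p T (Y K Y' K' : R -> 'rV[R]_n) : \bar R :=
  ereal_inf [set maxe (time_change_norm T lam)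
                   (pvar p 0 T (Y \o lam \- Y')%R + pvar p 0 T (K \o lam \- K')%R)%E
            | lam in [set lam | time_change T lam]].

Definition sigma_hat n d p q T (A : R -> 'rV[R]_d) (X L : R -> 'rV[R]_n)
    (A' : R -> 'rV[R]_d) (X' L' : R -> 'rV[R]_n) : \bar R :=
  ereal_inf [set maxe (time_change_norm T lam)
                   (pvar q 0 T (A \o lam \- A')%R + pvar p 0 T (X \o lam \- X')%R
                    + pvar p 0 T (L \o lam \- L')%R)%E
            | lam in [set lam | time_change T lam]].

End Paths.

(* Main.v *)
Require Import Defs.
From HB Require Import structures.
From mathcomp Require Import all_boot all_order all_algebra.
From mathcomp Require Import all_classical all_reals all_analysis.
From mathcomp Require Import measurable_realfun ring lra.
Import Order.TTheory GRing.Theory Num.Theory.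
Import numFieldNormedType.Exports.

Set Implicit Arguments.
Unset Strict Implicit.
Unset Printing Implicit Defensive.

Local Open Scope classical_set_scope.
Local Open Scope ring_scope.

(** * Stability of reflected Young equations

    Fix a time change [lam]. Composing a solution with [lam] gives a solution for
    the composed data, because [lam] is uniformly continuous and hence carries fine
    partitions to fine partitions ([reflected_path_time_change]). It is therefore
    enough to bound the p-variations of Y - Y' and K - K' by the distance of the
    data without time change, with a constant that depends on neither T nor the
    solutions; the infimum over [lam] is taken at the very end.

    Two facts give this bound. First, the Skorokhod map is Lipschitz in p-variation
    ([skorokhod_lipschitz]): if K and K' are the least increasing paths from 0
    above N and N', then in each monotone run of K - K' one of the two paths grows, so
    that it touches its obstacle and the end of the run compares with N - N' at that
    time. These times are in the same order as the runs, so the oscillations of K - K'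
    are dominated by oscillations of N - N'. The vanishing of the integral of Y - L
    against dK says precisely that K grows only where Y touches L
    ([stieltjes_touching]). Thus Y - Y' and K - K' are controlled by the difference
    I - I' of the two Young integrals and by the data.

    Secondly, Riemann sums satisfy Young's estimate uniformly in the partition
    ([discrete_sewing], [riemann_sum_ctrl]). Since f has two bounded derivatives,
    f(Y) - f(Y') has p-variation of the order of that of Y - Y', so on a set of times
    where A has small q-variation, I - I' is a small multiple of Y - Y' plus the
    distance of the data, and the small multiple is absorbed ([ctrl_absorb]).

    A may have large jumps, so [0, T] need not split into closed intervals on which A
    varies little. It does split into successive disjoint blocks, their number bounded
    in terms of M, on which a control of A increases by little
    ([stability_by_blocks]); the passage from one block to the next only sees the
    integrand before the jump, which the previous blocks have already estimated
    ([block_bound]). Induction on the blocks gives the estimate on [0, T].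

    The constant involves the p-variation of Y'. That one is bounded by the same
    stability estimate, applied to Y' and to the constant path at Y' 0, which solves
    an equation with constant data ([reflected_path_variation]). *)

(** * Inequalities for real powers *)

Section PowerInequalities.
Context {R : realType}.
Implicit Types a b x y r : R.

Lemma powR_mono r x y : 0 <= r -> 0 <= x -> x <= y -> x `^ r <= y `^ r.
Proof.
by move=> r0 x0 xy; apply: ge0_ler_powR; rewrite // nnegrE // (le_trans x0).
Qed.

Lemma powRVK r x : r != 0 -> 0 <= x -> (x `^ r^-1) `^ r = x.
Proof. by move=> r0 x0; rewrite -powRrM mulVf // powRr1. Qed.

Lemma powRKV r x : r != 0 -> 0 <= x -> (x `^ r) `^ r^-1 = x.
Proof. by move=> r0 x0; rewrite -powRrM mulfV // powRr1. Qed.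

Lemma powR_le1 r x : 0 <= r -> 0 <= x <= 1 -> x `^ r <= 1.
Proof.
move=> r0 /andP[x0 x1]; rewrite -[leRHS](congr1 (@^~ r) (@powR1 R)).
exact: powR_mono.
Qed.

Lemma powR_le_expo a x y : 0 < x -> x <= y -> 0 <= a <= 1 -> a `^ y <= a `^ x.
Proof.
move=> x0 xy /andP[]; rewrite le_eqVlt => /predU1P[<- _|a0 a1].
  by rewrite !powR0 // gt_eqF // (lt_le_trans x0).
by apply: ger_powR => //; rewrite a0.
Qed.

Lemma powR_inv_scale r c x : 1 <= r -> 1 <= c -> 0 <= x ->
  (c * x) `^ r^-1 <= c * x `^ r^-1.
Proof.
move=> r1 c1 x0; have c0 : 0 <= c by rewrite (le_trans _ c1).
rewrite powRM //; apply: ler_wpM2r; first exact: powR_ge0.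
by apply: ler1_powR => //; rewrite invf_le1 // (lt_le_trans _ r1).
Qed.

Lemma powR_superadd r x y : 1 <= r -> 0 <= x -> 0 <= y ->
  x `^ r + y `^ r <= (x + y) `^ r.
Proof.
move=> r1 x0 y0; have r0 : 0 <= r by rewrite (le_trans _ r1).
have rn0 : r != 0 by rewrite gt_eqF // (lt_le_trans _ r1).
have := addr_ge0 x0 y0; rewrite le_eqVlt => /predU1P[/esym/eqP|s0].
  by rewrite paddr_eq0 // => /andP[/eqP -> /eqP ->]; rewrite addr0 powR0 // addr0.
have h z : 0 <= z -> z <= x + y -> z `^ r <= (z / (x + y)) * (x + y) `^ r.
  move=> z0 zs; have -> : z `^ r = (z / (x + y)) `^ r * (x + y) `^ r.
    by rewrite -powRM ?divr_ge0 // ?(ltW s0) // divfK // gt_eqF.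
  apply: ler_wpM2r; first exact: powR_ge0.
  rewrite -[leRHS]powRr1 ?divr_ge0 // ?(ltW s0) //.
  apply: powR_le_expo => //.
  by rewrite divr_ge0 ?(ltW s0) //= ler_pdivrMr // mul1r.
have hx : x <= x + y by lra.
have hy : y <= x + y by lra.
apply: (le_trans (lerD (h x x0 hx) (h y y0 hy))).
by rewrite -mulrDl -mulrDl divff ?mul1r // gt_eqF.
Qed.

End PowerInequalities.

(** * Paths of finite variation and their controls *)

Section Controls.
Context {R : realType}.
Implicit Types (S U J : set R) (w : R -> R) (r p q V : R).

Definition control S w : Prop :=
  (forall t, S t -> 0 <= w t <= 1) /\
  (forall u v, S u -> S v -> u <= v -> w u <= w v).

(** The r-variation of Z on S is at most V when [|Z v - Z u|^r] is at most
    [V^r (w v - w u)] for an increasing [w] with values in [0, 1]: sums over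
    partitions telescope. Unlike the supremum over partitions, the additive [w] can
    be rescaled on a block and averaged with other controls. *)
Definition ctrl_by r S w (W : normedZmodType R) (Z : R -> W) V : Prop :=
  forall u v, S u -> S v -> u <= v ->
    `|Z v - Z u| <= V * (w v - w u) `^ r^-1.

Definition ctrl r S (W : normedZmodType R) (Z : R -> W) V : Prop :=
  exists2 w, control S w & ctrl_by r S w Z V.

Lemma control_diff S w u v : control S w -> S u -> S v -> u <= v ->
  0 <= w v - w u <= 1.
Proof.
move=> [w01 wm] Su Sv uv; have := w01 _ Su; have := w01 _ Sv.
by have := wm _ _ Su Sv uv; lra.
Qed.

Lemma control_mean S w1 w2 : control S w1 -> control S w2 ->
  control S (fun t => (w1 t + w2 t) / 2).
Proof.
move=> [a1 m1] [a2 m2]; split=> [t St|u v Su Sv uv].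
  by have := a1 _ St; have := a2 _ St; lra.
by have := m1 _ _ Su Sv uv; have := m2 _ _ Su Sv uv; lra.
Qed.

Lemma control_sub S U w : U `<=` S -> control S w -> control U w.
Proof.
by move=> US [a m]; split=> [t /US/a//|u v /US Su /US Sv]; exact: m.
Qed.

Lemma mean_root_l r S w1 w2 u v : 1 <= r -> control S w1 -> control S w2 ->
  S u -> S v -> u <= v ->
  (w1 v - w1 u) `^ r^-1 <=
  2 * ((w1 v + w2 v) / 2 - (w1 u + w2 u) / 2) `^ r^-1.
Proof.
move=> r1 c1 c2 Su Sv uv.
have d1 := control_diff c1 Su Sv uv; have d2 := control_diff c2 Su Sv uv.
apply: le_trans (powR_inv_scale r1 _ _); [|lra|lra].
apply: powR_mono; [|lra|lra].
by rewrite invr_ge0 (le_trans _ r1).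
Qed.

Lemma mean_root_r r S w1 w2 u v : 1 <= r -> control S w1 -> control S w2 ->
  S u -> S v -> u <= v ->
  (w2 v - w2 u) `^ r^-1 <=
  2 * ((w1 v + w2 v) / 2 - (w1 u + w2 u) / 2) `^ r^-1.
Proof.
move=> r1 c1 c2 Su Sv uv; rewrite [w1 v + _]addrC [w1 u + _]addrC.
exact: (mean_root_l r1 c2 c1 Su Sv uv).
Qed.

Lemma ctrl_sub r S U (W : normedZmodType R) (Z : R -> W) V :
  U `<=` S -> ctrl r S Z V -> ctrl r U Z V.
Proof.
move=> US [w cw wZ]; exists w; first exact: control_sub cw.
by move=> u v /US Su /US Sv; exact: wZ.
Qed.

Lemma ctrl_le r S (W : normedZmodType R) (Z : R -> W) V V' :
  V <= V' -> ctrl r S Z V -> ctrl r S Z V'.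
Proof.
move=> VV [w cw wZ]; exists w => // u v Su Sv uv.
by apply: le_trans (wZ _ _ Su Sv uv) _; rewrite ler_wpM2r // powR_ge0.
Qed.

Lemma ctrl_osc r S (W : normedZmodType R) (Z : R -> W) V u v :
  1 <= r -> 0 <= V -> ctrl r S Z V -> S u -> S v -> u <= v ->
  `|Z v - Z u| <= V.
Proof.
move=> r1 V0 [w cw wZ] Su Sv uv; apply: le_trans (wZ _ _ Su Sv uv) _.
rewrite ler_piMr //; apply: powR_le1; first by rewrite invr_ge0 (le_trans _ r1).
exact: control_diff cw Su Sv uv.
Qed.

Lemma ctrl_const r S (W : normedZmodType R) (Z : R -> W) V : 0 <= V ->
  (forall u v, S u -> S v -> Z u = Z v) -> ctrl r S Z V.
Proof.
move=> V0 Zc; exists (fun=> 0); first by split=> // t _; lra.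
by move=> u v Su Sv _; rewrite (Zc _ _ Sv Su) subrr normr0 mulr_ge0 // powR_ge0.
Qed.

Lemma ctrl_dom r S (W W1 : normedZmodType R) (Z : R -> W) (Z1 : R -> W1) a V1 :
  0 <= a ->
  (forall u v, S u -> S v -> u <= v -> `|Z v - Z u| <= a * `|Z1 v - Z1 u|) ->
  ctrl r S Z1 V1 -> ctrl r S Z (a * V1).
Proof.
move=> a0 h [w cw wZ]; exists w => // u v Su Sv uv.
by apply: le_trans (h _ _ Su Sv uv) _; rewrite -mulrA ler_wpM2l // wZ.
Qed.

Lemma ctrl_dom2 r S (W W1 W2 : normedZmodType R)
    (Z : R -> W) (Z1 : R -> W1) (Z2 : R -> W2) a b V1 V2 :
  1 <= r -> 0 <= a -> 0 <= b -> 0 <= V1 -> 0 <= V2 ->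
  (forall u v, S u -> S v -> u <= v ->
    `|Z v - Z u| <= a * `|Z1 v - Z1 u| + b * `|Z2 v - Z2 u|) ->
  ctrl r S Z1 V1 -> ctrl r S Z2 V2 -> ctrl r S Z (2 * (a * V1 + b * V2)).
Proof.
move=> r1 a0 b0 V10 V20 h [w1 c1 wZ1] [w2 c2 wZ2].
exists (fun t => (w1 t + w2 t) / 2); first exact: control_mean.
move=> u v Su Sv uv; apply: le_trans (h _ _ Su Sv uv) _.
rewrite [2 * _]mulrC -mulrA mulrDl -!mulrA lerD // ler_wpM2l //.
  apply: le_trans (wZ1 _ _ Su Sv uv) _; rewrite ler_wpM2l //.
  exact: (mean_root_l r1 c1 c2).
apply: le_trans (wZ2 _ _ Su Sv uv) _; rewrite ler_wpM2l //.
exact: (mean_root_r r1 c1 c2).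
Qed.

Lemma ctrl_add r S (W : normedZmodType R) (Z Z1 Z2 : R -> W) V1 V2 :
  1 <= r -> 0 <= V1 -> 0 <= V2 ->
  (forall u v, S u -> S v -> u <= v ->
     Z v - Z u = (Z1 v - Z1 u) + (Z2 v - Z2 u)) ->
  ctrl r S Z1 V1 -> ctrl r S Z2 V2 -> ctrl r S Z (2 * (V1 + V2)).
Proof.
move=> r1 V10 V20 h c1 c2; rewrite -[V1]mul1r -[V2]mul1r.
apply: ctrl_dom2 c1 c2 => // u v Su Sv uv; rewrite h // !mul1r.
exact: ler_normD.
Qed.

(** A control of a union of two successive blocks spends a third of its mass on
    each block and the last third on the passage between them. *)
Lemma ctrl_glue r U J (W : normedZmodType R) (Z : R -> W) V1 V2 V3 :
  1 <= r -> 0 <= V1 -> 0 <= V2 -> 0 <= V3 ->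
  (forall u v, U u -> J v -> u < v) ->
  (forall u v, U u -> J v -> `|Z v - Z u| <= V3) ->
  ctrl r U Z V1 -> ctrl r J Z V2 -> ctrl r (U `|` J) Z (3 * (V1 + V2 + V3)).
Proof.
move=> r1 V10 V20 V30 UJ cross [w1 c1 wZ1] [w2 c2 wZ2].
have ri0 : 0 <= r^-1 by rewrite invr_ge0 (le_trans _ r1).
pose w t := if t \in U then w1 t / 3 else (2 + w2 t) / 3.
have wU t : U t -> w t = w1 t / 3 by rewrite /w => /mem_set ->.
have wJ t : J t -> w t = (2 + w2 t) / 3.
  move=> Jt; rewrite /w; case: ifP => // /set_mem Ut.
  by have := UJ _ _ Ut Jt; rewrite ltxx.
clearbody w; have scale x y : 0 <= x -> 3 * y = x -> x `^ r^-1 <= 3 * y `^ r^-1.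
  by move=> x0 e; rewrite -e; apply: powR_inv_scale => //; lra.
have b1 : 3 * V1 <= 3 * (V1 + V2 + V3) by lra.
have b2 : 3 * V2 <= 3 * (V1 + V2 + V3) by lra.
have b3 : 3 * V3 <= 3 * (V1 + V2 + V3) by lra.
exists w; first split.
- move=> t [Ut|Jt]; first by rewrite wU //; have := c1.1 _ Ut; lra.
  by rewrite wJ //; have := c2.1 _ Jt; lra.
- move=> u v [Uu|Ju] [Uv|Jv] uv.
  + by rewrite !wU //; have := c1.2 _ _ Uu Uv uv; lra.
  + by rewrite (wU u) // (wJ v) //; have := c1.1 _ Uu; have := c2.1 _ Jv; lra.
  + by have := UJ _ _ Uv Ju; rewrite ltNge uv.
  + by rewrite !wJ //; have := c2.2 _ _ Ju Jv uv; lra.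
- move=> u v [Uu|Ju] [Uv|Jv] uv.
  + apply: le_trans (wZ1 _ _ Uu Uv uv) _; have d := control_diff c1 Uu Uv uv.
    apply: le_trans (ler_wpM2r (powR_ge0 _ _) b1).
    rewrite [3 * _]mulrC -mulrA ler_wpM2l // scale; [by []|lra|].
    by rewrite !wU //; field.
  + apply: le_trans (cross _ _ Uu Jv) _.
    apply: le_trans (ler_wpM2r (powR_ge0 _ _) b3).
    rewrite [3 * _]mulrC -mulrA ler_peMr //.
    have e1 : (1 : R) `^ r^-1 = 1 by rewrite (congr1 (@^~ r^-1) (powR1 R)).
    apply: (@le_trans _ _ (1 `^ r^-1)); first by rewrite e1.
    apply: (@le_trans _ _ ((3 * (w v - w u)) `^ r^-1)).
      apply: powR_mono => //; rewrite (wU u) // (wJ v) //.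
      by have := c1.1 _ Uu; have := c2.1 _ Jv; lra.
    apply: powR_inv_scale => //; first lra.
    by rewrite (wU u) // (wJ v) //; have := c1.1 _ Uu; have := c2.1 _ Jv; lra.
  + by have := UJ _ _ Uv Ju; rewrite ltNge uv.
  + apply: le_trans (wZ2 _ _ Ju Jv uv) _; have d := control_diff c2 Ju Jv uv.
    apply: le_trans (ler_wpM2r (powR_ge0 _ _) b2).
    rewrite [3 * _]mulrC -mulrA ler_wpM2l // scale; [by []|lra|].
    by rewrite !wJ //; field.
Qed.

Lemma ctrl_comp r S U (W : normedZmodType R) (Z : R -> W) (lam : R -> R) V :
  (forall t, U t -> S (lam t)) ->
  (forall u v, U u -> U v -> u <= v -> lam u <= lam v) ->
  ctrl r S Z V -> ctrl r U (Z \o lam) V.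
Proof.
move=> lS lm [w [w01 wm] wZ]; exists (w \o lam) => [|u v Uu Uv uv /=].
  split=> [t /lS/w01//|u v Uu Uv uv /=].
  by apply: wm; [exact: lS|exact: lS|exact: lm].
by apply: wZ; [exact: lS|exact: lS|exact: lm].
Qed.

(** Since the estimates below only bound the new size of Z by [a] plus half of
    the old one, a bound that is known to exist can be halved until it is
    comparable with [a]. *)
Lemma ctrl_absorb r S (W : normedZmodType R) (Z : R -> W) a V : 0 < a ->
  0 <= V -> ctrl r S Z V ->
  (forall V', 0 <= V' -> ctrl r S Z V' -> ctrl r S Z (a + V' / 2)) ->
  ctrl r S Z (3 * a).
Proof.
move=> a0 V0 cV h.
have hk k : ctrl r S Z (2 * a + V / 2 ^+ k).
  elim: k => [|k ih]; first by rewrite expr0 divr1; apply: ctrl_le cV; lra.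
  have V'0 : 0 <= V / 2 ^+ k by rewrite divr_ge0 // exprn_ge0.
  apply: ctrl_le (h _ _ ih); last by lra.
  by rewrite exprSr invfM mulrA; lra.
have [k hk'] : exists k : nat, V / 2 ^+ k <= a.
  exists (Num.truncn (V / a)).+1; rewrite ler_pdivrMr ?exprn_gt0 //.
  rewrite mulrC -ler_pdivrMr //.
  have := ltW (truncnS_gt (V / a)); move/le_trans; apply.
  by rewrite -natrX ler_nat ltnW // ltn_expl.
by apply: ctrl_le (hk k); lra.
Qed.

End Controls.

(** * Sums over partitions and Young's estimate *)

Section PartitionSums.
Context {R : realType}.
Implicit Types (a b e : R) (s : seq R).

Lemma partition_sum_nil (V : nmodType) (g : R -> R -> V) a :
  partition_sum g a [::] = 0.
Proof. by rewrite /partition_sum big_ord0. Qed.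

Lemma partition_sum_cons (V : nmodType) (g : R -> R -> V) a x s :
  partition_sum g a (x :: s) = g a x + partition_sum g x s.
Proof.
rewrite /partition_sum /= big_ord_recl /=; congr (_ + _).
apply: eq_bigr => i _.
congr (g _ _); last by apply: set_nth_default; rewrite ltn_ord.
rewrite add0n; apply: set_nth_default; exact: leqW (ltn_ord i).
Qed.

Lemma partition_sum_cat (V : nmodType) (g : R -> R -> V) a s1 s2 :
  partition_sum g a (s1 ++ s2) =
  partition_sum g a s1 + partition_sum g (last a s1) s2.
Proof.
elim: s1 a => [|x s1 ih] a /=; first by rewrite partition_sum_nil add0r.
by rewrite !partition_sum_cons ih addrA.
Qed.

Lemma partition_sumB (V : zmodType) (g h : R -> R -> V) a s :
  partition_sum (fun u v => g u v - h u v) a s =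
  partition_sum g a s - partition_sum h a s.
Proof. by rewrite /partition_sum sumrB. Qed.

Lemma path_last_le a s : path <%R a s -> a <= last a s.
Proof.
by elim: s a => //= x s ih a /andP[ax /ih]; apply: le_trans; exact: ltW.
Qed.

Lemma path_lt_mem a s x : path <%R a s -> x \in a :: s -> a <= x <= last a s.
Proof.
elim: s a => [|y s ih] a /=; first by rewrite inE => _ /eqP ->; rewrite lexx.
move=> /andP[ay ys]; rewrite inE => /orP[/eqP ->|/(ih _ ys)/andP[yx ->]].
  by rewrite lexx /= (le_trans (ltW ay)) // path_last_le.
by rewrite (le_trans (ltW ay)).
Qed.

Lemma mesh_lt a s e : 0 < e ->
  (mesh a s < e) = path (fun u v => v - u < e) a s.
Proof.
move=> e0; apply/idP/(pathP a) => [h i si|h]; last first.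
  rewrite /mesh; elim/big_ind : _ => // [x y xe ye|i _].
    by rewrite gt_max xe.
  by rewrite /= h.
apply: le_lt_trans h; rewrite /mesh.
exact: (@le_bigmax _ _ _ 0 (fun j : 'I_(size s) =>
  nth a (a :: s) j.+1 - nth a (a :: s) j) (Ordinal si)).
Qed.

Lemma mesh_cat a s1 s2 e : 0 < e ->
  (mesh a (s1 ++ s2) < e) = (mesh a s1 < e) && (mesh (last a s1) s2 < e).
Proof. by move=> e0; rewrite !mesh_lt // cat_path. Qed.

Lemma exists_partition a b e : a <= b -> 0 < e ->
  exists s, itv_partition a b s /\ mesh a s < e.
Proof.
move=> ab e0.
have [k hk] : exists k : nat, b - a < e * 2 ^+ k.
  exists (Num.truncn ((b - a) / e)).+1; rewrite -ltr_pdivrMl // mulrC.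
  apply: lt_trans (truncnS_gt _) _.
  by rewrite -natrX ltr_nat ltn_expl.
elim: k a b ab hk => [|k ih] a b ab hk.
  move: ab; rewrite le_eqVlt => /predU1P[<-|ab].
    by exists [::]; split; rewrite // mesh_lt.
  exists [:: b]; split; first exact: itv_partition1.
  by rewrite mesh_lt //= andbT; rewrite expr0 mulr1 in hk.
pose m := (a + b) / 2.
have [am mb] : a <= m /\ m <= b by rewrite /m; split; lra.
have [||s1 [p1 m1]] := ih a m; [by []|rewrite exprS in hk; rewrite /m; lra|].
have [||s2 [p2 m2]] := ih m b; [by []|rewrite exprS in hk; rewrite /m; lra|].
exists (s1 ++ s2); split; first exact: itv_partition_cat p1 p2.
by case: p1 => _ /eqP l1; rewrite mesh_cat // m1 l1.
Qed.

End PartitionSums.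

Section DiscreteSewing.
Context {R : realType} {W : normedZmodType R}.
Implicit Types (a b c th : R) (s : seq R) (w : R -> R) (S : set R).

(** The fixed point of C |-> 2^(1 - th) C + 2. *)
Definition sewing_const th : R := 2 / (1 - 2 `^ (1 - th)).

Lemma sewing_const_fix th : 1 < th ->
  0 < sewing_const th /\
  sewing_const th * 2 `^ (1 - th) + 2 = sewing_const th.
Proof.
move=> th1; rewrite /sewing_const.
have h : 2 `^ (1 - th) < (1 : R).
  have -> : 1 - th = - (th - 1) by lra.
  rewrite powRN invf_lt1 ?powR_gt0 //.
  have e1 : (1 : R) `^ (th - 1) = 1 by rewrite (congr1 (@^~ (th - 1)) (powR1 R)).
  rewrite -[ltLHS]e1; apply: gt0_ltr_powR; rewrite ?nnegrE //; lra.
split; first by rewrite divr_gt0 //; lra.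
have hne : 1 - 2 `^ (1 - th) != 0 by rewrite gt_eqF //; lra.
by field.
Qed.

(** The step from [last a s1] to [y] is the one that crosses the level [m], or the
    last one. *)
Lemma split_at_level w m a s : w a <= m -> s != [::] ->
  exists s1 y s2, [/\ s = s1 ++ y :: s2, w (last a s1) <= m &
    s2 = [::] \/ m < w y].
Proof.
elim: s a => // y s ih a wa _; case: (leP (w y) m) => wy; last first.
  by exists [::], y, s; split=> //; right.
case: s ih => [|z s] ih; first by exists [::], y, [::]; split=> //; left.
have [//|s1 [y' [s2 [-> h1 h2]]]] := ih y wy.
by exists (y :: s1), y', s2.
Qed.

(** Young's estimate in the form of a discrete sewing lemma: as the defect is
    superlinear in the mass of [w], cutting the partition at the point where
    half of that mass is reached gives a contraction, whatever the number of
    points. *)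
Lemma discrete_sewing th c S w (Xi : R -> R -> W) a s :
  1 < th -> 0 <= c ->
  (forall u v, S u -> S v -> u <= v -> w u <= w v) ->
  (forall u v x, S u -> S v -> S x -> u <= v -> v <= x ->
     `|Xi u x - Xi u v - Xi v x| <= c * (w x - w u) `^ th) ->
  path <%R a s -> (forall t, t \in a :: s -> S t) ->
  `|partition_sum Xi a s - Xi a (last a s)| <=
    sewing_const th * c * (w (last a s) - w a) `^ th.
Proof.
move=> th1 c0 wm dXi.
have th0 : 0 < th by lra.
have [C0 Cfix] := sewing_const_fix th1.
set C := sewing_const th in C0 Cfix *.
have [n] := ubnP (size s); elim: n a s => // n ih a s.
have [->|s0] := eqVneq s [::].
  move=> _ _ Sa; rewrite partition_sum_nil /= sub0r normrN.
  have Sa' : S a by apply: Sa; rewrite inE.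
  have := dXi _ _ _ Sa' Sa' Sa' (lexx a) (lexx a).
  rewrite !subrr sub0r normrN powR0 ?gt_eqF // !mulr0 => /le_trans; apply.
  by [].
move=> ssz pas Sas.
have ab : a <= last a s by exact: path_last_le.
have Sa : S a by apply: Sas; rewrite inE eqxx.
have Sb : S (last a s) by apply: Sas; exact: mem_last.
have wab := wm _ _ Sa Sb ab.
set b := last a s in ab Sb wab *; set M := w b - w a.
have [|s1 [y [s2 [es wx wy]]]] := @split_at_level w (w a + M / 2) a s _ s0.
  by rewrite /M; lra.
set x := last a s1 in wx.
move: pas; rewrite {1}es cat_path /= -/x => /and3P[p1 xy p2].
have by_ : b = last y s2 by rewrite /b es last_cat.
have Sx : S x.
  apply: Sas; rewrite es -cat_cons mem_cat /x.
  by rewrite mem_last.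
have Sy : S y by apply: Sas; rewrite es !(inE, mem_cat) eqxx !orbT.
have ax : a <= x by exact: path_last_le.
have yb : y <= b by rewrite by_ path_last_le.
have xb : x <= b by rewrite (le_trans (ltW xy)).
have sz1 : (size s1 < n)%N.
  move: ssz; rewrite es size_cat /= => h.
  by apply: leq_trans (leq_addr (size s2) _) _; move: h; rewrite addnS ltnS.
have sz2 : (size s2 < n)%N.
  move: ssz; rewrite es size_cat /= => h.
  by apply: leq_trans (leq_addl (size s1) _) _; move: h; rewrite addnS ltnS.
have S1 t : t \in a :: s1 -> S t.
  by move=> h; apply: Sas; rewrite es -cat_cons mem_cat h.
have S2 t : t \in y :: s2 -> S t.
  by move=> h; apply: Sas; rewrite es inE mem_cat h !orbT.
have h1 := ih a s1 sz1 p1 S1; have h2 := ih y s2 sz2 p2 S2.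
rewrite -/x in h1; rewrite -by_ in h2.
have wax := wm _ _ Sa Sx ax; have wyb := wm _ _ Sy Sb yb.
have half z : 0 <= z <= M / 2 -> 2 * z `^ th <= 2 `^ (1 - th) * M `^ th.
  move=> /andP[z0 zM].
  have -> : 2 `^ (1 - th) = 2 * (2 : R) `^ (- th).
    by rewrite powRD ?powRr1 //; apply/implyP => _; rewrite pnatr_eq0.
  rewrite powRN -mulrA ler_wpM2l //.
  rewrite ler_pdivlMl ?powR_gt0 // -powRM //.
  by apply: powR_mono; [lra|lra|rewrite /M in zM *; lra].
have k1 : 2 * (w x - w a) `^ th <= 2 `^ (1 - th) * M `^ th by apply: half; lra.
have k2 : 2 * (w b - w y) `^ th <= 2 `^ (1 - th) * M `^ th.
  apply: half; case: wy => [s20|]; last by rewrite /M; lra.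
  by rewrite by_ s20 /= subrr lexx /=; rewrite /M; lra.
have d1 := dXi _ _ _ Sa Sx Sb ax xb.
have d2 := dXi _ _ _ Sx Sy Sb (ltW xy) yb.
have k3 : (w b - w x) `^ th <= M `^ th.
  by apply: powR_mono; [lra|have := wm _ _ Sx Sb xb; lra|rewrite /M; lra].
have -> : partition_sum Xi a s - Xi a b =
    (partition_sum Xi a s1 - Xi a x) + (partition_sum Xi y s2 - Xi y b)
    - (Xi a b - Xi a x - Xi x b) - (Xi x b - Xi x y - Xi y b).
  rewrite es partition_sum_cat partition_sum_cons -/x.
  set D1 := Xi a b - _ - _; set D2 := Xi x b - _ - _.
  have e2 : Xi x b = D2 + Xi y b + Xi x y by rewrite !subrK.
  have e1 : Xi a b = D1 + Xi x b + Xi a x by rewrite !subrK.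
  clearbody D1 D2; rewrite e1 e2 !opprD !addrA.
  by rewrite [LHS](ACl (1*8*3*6*4*5*2*7))%AC /= addrK.
apply: (@le_trans _ _ (C * c * (w x - w a) `^ th + C * c * (w b - w y) `^ th
   + c * M `^ th + c * (w b - w x) `^ th)).
  apply: le_trans (ler_normB _ _) _; apply: lerD => //.
  apply: le_trans (ler_normB _ _) _; apply: lerD => //.
  by apply: le_trans (ler_normD _ _) _; apply: lerD.
have Cc : 0 <= C * c by rewrite mulr_ge0 // ltW.
have g1 := ler_wpM2l Cc k1; have g2 := ler_wpM2l Cc k2.
have g3 := ler_wpM2l c0 k3.
have -> : C * c * M `^ th = C * c * (2 `^ (1 - th) * M `^ th) + 2 * (c * M `^ th).
  by rewrite -{1}Cfix; ring.
lra.
Qed.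

End DiscreteSewing.

(** * Riemann sums of matrix-valued paths *)

Section MatrixNorms.
Context {R : realType}.

Lemma mx_norm_entry m n (M : 'M[R]_(m, n)) i j : `|M i j| <= `|M|.
Proof.
rewrite [leRHS](mx_normrE M).
exact: (@le_bigmax _ _ _ 0 (fun ij : 'I_m * 'I_n => `|M ij.1 ij.2|) (i, j)).
Qed.

Lemma mx_norm_le m n (M : 'M[R]_(m, n)) c :
  0 <= c -> (forall i j, `|M i j| <= c) -> `|M| <= c.
Proof.
move=> c0 h; rewrite [leLHS](mx_normrE M); elim/big_ind : _ => // x y xc yc.
by rewrite ge_max xc.
Qed.

Lemma mx_norm_mul d n (v : 'rV[R]_d) (H : 'M[R]_(d, n)) :
  `|v *m H| <= d%:R * `|v| * `|H|.
Proof.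
apply: mx_norm_le => [|i j]; first by rewrite !mulr_ge0.
rewrite mxE; apply: le_trans (ler_norm_sum _ _ _) _.
apply: (@le_trans _ _ (\sum_(k < d) `|v| * `|H|)).
  apply: ler_sum => k _; rewrite normrM.
  by apply: ler_pM; rewrite // mx_norm_entry.
by rewrite sumr_const card_ord -[leLHS]mulr_natl mulrA.
Qed.

Lemma mx_norm_le_enorm n (v : 'rV[R]_n) : `|v| <= enorm v.
Proof.
apply: mx_norm_le => [|i j]; first exact: sqrtr_ge0.
rewrite ord1 /enorm -sqrtr_sqr; apply: ler_wsqrtr.
by rewrite (bigD1 j) //= lerDl sumr_ge0 // => k _; exact: sqr_ge0.
Qed.

Lemma enorm_le_mx_norm n (v : 'rV[R]_n) : enorm v <= n%:R * `|v|.
Proof.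
have h : 0 <= n%:R * `|v| by rewrite mulr_ge0.
rewrite /enorm -[leRHS]ger0_norm // -sqrtr_sqr; apply: ler_wsqrtr.
apply: (@le_trans _ _ (n%:R * `|v| ^+ 2)).
  have -> : n%:R * `|v| ^+ 2 = \sum_(i < n) `|v| ^+ 2.
    by rewrite sumr_const card_ord mulr_natl.
  apply: ler_sum => i _.
  by rewrite -real_normK ?num_real // ler_pXn2r ?nnegrE // mx_norm_entry.
rewrite exprMn ler_wpM2r ?sqr_ge0 // -natrX ler_nat.
by case: n {v h} => // n; rewrite expnS leq_pmulr.
Qed.

End MatrixNorms.

Section RiemannSums.
Context {R : realType}.
Variables (n d : nat) (p q : R).
Hypotheses (q1 : 1 <= q) (qp : q <= p) (pq : 1 < p^-1 + q^-1).

Definition young_const : R := d%:R * (16 * sewing_const (p^-1 + q^-1) + 4).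

Let p1 : 1 <= p. Proof. exact: le_trans qp. Qed.

Lemma young_const_ge0 : 0 <= young_const.
Proof. by rewrite mulr_ge0 // addr_ge0 // mulr_ge0 // ltW // (sewing_const_fix pq).1. Qed.

(** Young's estimate is applied to the Riemann sums themselves. It is uniform in the
    partition, and so passes to the limit in the mesh. *)
Lemma riemann_sum_ctrl (S : set R) (H G : R -> 'M[R]_(d, n))
    (A B : R -> 'rV[R]_d) (VH VG VA VB h g : R) :
  0 <= VH -> 0 <= VG -> 0 <= VA -> 0 <= VB -> 0 <= h -> 0 <= g ->
  ctrl p S H VH -> ctrl p S G VG -> ctrl q S A VA -> ctrl q S B VB ->
  (forall t, S t -> `|H t| <= h) -> (forall t, S t -> `|G t| <= g) ->
  exists2 w, control S w & forall a s,
    path <%R a s -> (forall t, t \in a :: s -> S t) ->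
    `|partition_sum (fun u v => (A v - A u) *m H u + (B v - B u) *m G u) a s|
    <= young_const * (VA * (h + VH) + VB * (g + VG))
       * (w (last a s) - w a) `^ p^-1.
Proof.
move=> VH0 VG0 VA0 VB0 h0 g0 [wH cH bH] [wG cG bG] [wA cA bA] [wB cB bB] Hh Gg.
pose w1 t := (wH t + wA t) / 2; pose w2 t := (wG t + wB t) / 2.
have c1 : control S w1 by exact: control_mean.
have c2 : control S w2 by exact: control_mean.
pose w t := (w1 t + w2 t) / 2.
have cw : control S w by exact: control_mean.
have two (x y z : R) : x <= 2 * y -> y <= 2 * z -> x <= 4 * z by lra.
have dH u v : S u -> S v -> u <= v -> `|H v - H u| <= VH * (4 * (w v - w u) `^ p^-1).
  move=> Su Sv uv; apply: le_trans (bH _ _ Su Sv uv) _; rewrite ler_wpM2l //.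
  exact: two (mean_root_l p1 cH cA Su Sv uv) (mean_root_l p1 c1 c2 Su Sv uv).
have dG u v : S u -> S v -> u <= v -> `|G v - G u| <= VG * (4 * (w v - w u) `^ p^-1).
  move=> Su Sv uv; apply: le_trans (bG _ _ Su Sv uv) _; rewrite ler_wpM2l //.
  exact: two (mean_root_l p1 cG cB Su Sv uv) (mean_root_r p1 c1 c2 Su Sv uv).
have dA u v : S u -> S v -> u <= v -> `|A v - A u| <= VA * (4 * (w v - w u) `^ q^-1).
  move=> Su Sv uv; apply: le_trans (bA _ _ Su Sv uv) _; rewrite ler_wpM2l //.
  exact: two (mean_root_r q1 cH cA Su Sv uv) (mean_root_l q1 c1 c2 Su Sv uv).
have dB u v : S u -> S v -> u <= v -> `|B v - B u| <= VB * (4 * (w v - w u) `^ q^-1).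
  move=> Su Sv uv; apply: le_trans (bB _ _ Su Sv uv) _; rewrite ler_wpM2l //.
  exact: two (mean_root_r q1 cG cB Su Sv uv) (mean_root_r q1 c1 c2 Su Sv uv).
exists w => // a s pas Sas.
have th1 := pq; set Xi := fun u v => _; set th := p^-1 + q^-1 in th1 *.
have p0 : 0 < p by rewrite (lt_le_trans _ p1).
have q0 : 0 < q by rewrite (lt_le_trans _ q1).
have pi0 : 0 < p^-1 by rewrite invr_gt0.
have qi0 : 0 < q^-1 by rewrite invr_gt0.
have C0 : 0 < sewing_const th by have [] := sewing_const_fix th1.
set C := sewing_const th in C0.
have Sa : S a by apply: Sas; rewrite inE eqxx.
have Sb : S (last a s) by apply: Sas; exact: mem_last.
have ab := path_last_le pas; set b := last a s in Sb ab *.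
have dXi u v x : S u -> S v -> S x -> u <= v -> v <= x ->
    `|Xi u x - Xi u v - Xi v x| <=
    d%:R * 16 * (VA * VH + VB * VG) * (w x - w u) `^ th.
  move=> Su Sv Sx uv vx.
  have -> : Xi u x - Xi u v - Xi v x =
      (A x - A v) *m (H u - H v) + (B x - B v) *m (G u - G v).
    rewrite /Xi !mulmxBr !mulmxBl.
    move: (A x *m H u) (A u *m H u) (A v *m H u) (A v *m H v) (A x *m H v).
    move: (B x *m G u) (B u *m G u) (B v *m G u) (B v *m G v) (B x *m G v).
    by move=> b1 b2 b3 b4 b5 a1 a2 a3 a4 a5; apply/matrixP => i j; rewrite !mxE; ring.
  have ux := le_trans uv vx; have dw := control_diff cw Su Sx ux.
  have wv : w u <= w v by exact: cw.2.
  have wx : w v <= w x by exact: cw.2.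
  set D := w x - w u in dw *.
  have -> : D `^ th = D `^ p^-1 * D `^ q^-1.
    by rewrite powRD //; apply/implyP => /eqP; rewrite -/th; lra.
  have small1 r : 0 < r -> (w v - w u) `^ r <= D `^ r.
    by move=> r0; apply: powR_mono; [exact: ltW|lra|rewrite /D; lra].
  have small2 r : 0 < r -> (w x - w v) `^ r <= D `^ r.
    by move=> r0; apply: powR_mono; [exact: ltW|lra|rewrite /D; lra].
  have Hle : `|H u - H v| <= VH * (4 * D `^ p^-1).
    rewrite distrC; apply: le_trans (dH _ _ Su Sv uv) _.
    by rewrite !ler_wpM2l // small1.
  have Gle : `|G u - G v| <= VG * (4 * D `^ p^-1).
    rewrite distrC; apply: le_trans (dG _ _ Su Sv uv) _.
    by rewrite !ler_wpM2l // small1.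
  have Ale : `|A x - A v| <= VA * (4 * D `^ q^-1).
    by apply: le_trans (dA _ _ Sv Sx vx) _; rewrite !ler_wpM2l // small2.
  have Ble : `|B x - B v| <= VB * (4 * D `^ q^-1).
    by apply: le_trans (dB _ _ Sv Sx vx) _; rewrite !ler_wpM2l // small2.
  apply: le_trans (ler_normD _ _) _.
  apply: (@le_trans _ _ (d%:R * (VA * (4 * D `^ q^-1)) * (VH * (4 * D `^ p^-1))
    + d%:R * (VB * (4 * D `^ q^-1)) * (VG * (4 * D `^ p^-1)))); last first.
    by rewrite le_eqVlt; apply/orP; left; apply/eqP; ring.
  by apply: lerD; (apply: le_trans (mx_norm_mul _ _) _; apply: ler_pM;
    rewrite ?mulr_ge0 ?ler_wpM2l //).
have K0 : 0 <= d%:R * 16 * (VA * VH + VB * VG) :> R.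
  by rewrite !(mulr_ge0, addr_ge0).
have sew := discrete_sewing th1 K0 cw.2 dXi pas Sas.
have dw := control_diff cw Sa Sb ab.
rewrite -/b in sew *; set D := w b - w a in dw sew *.
have Dth : D `^ th <= D `^ p^-1.
  by apply: powR_le_expo => //; rewrite /th lerDl ltW.
have Dq : D `^ q^-1 <= D `^ p^-1.
  by apply: powR_le_expo => //; rewrite lef_pV2 // posrE.
have Xiab : `|Xi a b| <= d%:R * 4 * (VA * h + VB * g) * D `^ p^-1.
  apply: le_trans (ler_normD _ _) _.
  apply: (@le_trans _ _ (d%:R * (VA * (4 * D `^ p^-1)) * h
    + d%:R * (VB * (4 * D `^ p^-1)) * g)); last first.
    by rewrite le_eqVlt; apply/orP; left; apply/eqP; ring.
  apply: lerD; (apply: le_trans (mx_norm_mul _ _) _; apply: ler_pM;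
    rewrite ?mulr_ge0 //; [rewrite ler_wpM2l //|exact: Hh || exact: Gg]).
    by apply: le_trans (dA _ _ Sa Sb ab) _; rewrite !ler_wpM2l.
  by apply: le_trans (dB _ _ Sa Sb ab) _; rewrite !ler_wpM2l.
have -> : partition_sum Xi a s = (partition_sum Xi a s - Xi a b) + Xi a b.
  by rewrite subrK.
apply: le_trans (ler_normD _ _) _.
apply: le_trans (lerD sew Xiab) _.
apply: (@le_trans _ _ (C * (d%:R * 16 * (VA * VH + VB * VG)) * D `^ p^-1
   + d%:R * 4 * (VA * h + VB * g) * D `^ p^-1)).
  by rewrite lerD2r ler_wpM2l // mulr_ge0 // ltW.
rewrite -mulrDl ler_wpM2r ?powR_ge0 // /young_const -/th -/C.
have e1 : 0 <= C * (d%:R * 16 * (VA * h + VB * g)).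
  by rewrite mulr_ge0 ?(ltW C0) // mulr_ge0 // addr_ge0 // mulr_ge0.
have e2 : 0 <= d%:R * 4 * (VA * VH + VB * VG) :> R.
  by rewrite !(mulr_ge0, addr_ge0).
by rewrite -subr_ge0; apply: le_trans (addr_ge0 e1 e2) _;
  rewrite le_eqVlt; apply/orP; left; apply/eqP; ring.
Qed.

End RiemannSums.

(** * The Skorokhod map in p-variation *)

Section ControlFromSums.
Context {R : realType}.

(** The bounds hold on initial segments of the time interval: containing 0
    makes every value of a path comparable with the initial one. *)
Definition initial_segment (U : set R) : Prop :=
  [/\ U 0, forall t, U t -> 0 <= t & forall s t, U t -> 0 <= s <= t -> U s].

(** The running supremum of the sums of r-th powers is a control. *)
Lemma ctrl_of_sums r (U : set R) (W : normedZmodType R) (Z : R -> W) V :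
  1 <= r -> 0 < V -> initial_segment U ->
  (forall t s, U t -> itv_partition 0 t s ->
    partition_sum (fun u v => `|Z v - Z u| `^ r) 0 s <= V `^ r) ->
  ctrl r U Z V.
Proof.
move=> r1 V0 [U0 Upos _] hs.
have rn0 : r != 0 by rewrite gt_eqF // (lt_le_trans _ r1).
have rp : 0 <= r^-1 by rewrite invr_ge0 (le_trans _ r1).
have Vr : 0 < V `^ r by exact: powR_gt0.
pose g u v := `|Z v - Z u| `^ r.
pose E t := [set partition_sum g 0 s | s in [set s | itv_partition 0 t s]].
have E0 t : U t -> E t !=set0.
  move=> Ut; have := Upos _ Ut; rewrite le_eqVlt => /predU1P[<-|t0].
    by exists (partition_sum g 0 [::]); exists [::].
  by exists (partition_sum g 0 [:: t]); exists [:: t] => //; exact: itv_partition1.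
have Eub t : U t -> ubound (E t) (V `^ r).
  by move=> Ut _ [s /= ps <-]; exact: hs ps.
have Epos t x : E t x -> 0 <= x.
  by move=> [s _ <-]; apply: sumr_ge0 => i _; exact: powR_ge0.
have supE t x : U t -> E t x -> x <= sup (E t).
  by move=> Ut Ex; apply: ub_le_sup => //; exists (V `^ r); exact: Eub.
have step u v : U u -> U v -> u <= v -> g u v <= sup (E v) - sup (E u).
  move=> Uu Uv; rewrite le_eqVlt => /predU1P[<-|uv].
    by rewrite /g !subrr normr0 powR0.
  rewrite lerBrDr addrC -lerBrDr; apply: ge_sup; first exact: E0.
  move=> _ [s /= [ps /eqP ls] <-]; rewrite lerBrDr; apply: supE => //.
  exists (rcons s v) => /=.
    by split; rewrite ?last_rcons // rcons_path ps ls.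
  by rewrite -cats1 partition_sum_cat partition_sum_cons partition_sum_nil addr0 ls.
exists (fun t => sup (E t) / V `^ r); first split.
- move=> t Ut; rewrite ler_pdivrMr // mul1r.
  have [x Ex] := E0 _ Ut.
  rewrite (ge_sup (E0 _ Ut)) ?andbT; last exact: Eub.
  by apply: divr_ge0; [exact: le_trans (Epos _ _ Ex) (supE _ _ Ut Ex)|exact: ltW].
- move=> u v Uu Uv uv; rewrite ler_pM2r ?invr_gt0 // -subr_ge0.
  by apply: le_trans (step _ _ Uu Uv uv); exact: powR_ge0.
- move=> u v Uu Uv uv.
  rewrite -mulrBl -[leLHS](powRKV rn0) // -[X in X * _](powRKV rn0 (ltW V0)).
  have g0 : 0 <= g u v by exact: powR_ge0.
  have s := step _ _ Uu Uv uv; have s0 := le_trans g0 s.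
  rewrite -powRM ?divr_ge0 ?(ltW Vr) //.
  by rewrite mulrC divfK ?gt_eqF //; apply: powR_mono.
Qed.

End ControlFromSums.

Section Skorokhod.
Context {R : realType}.
Implicit Types (U : set R) (K N : R -> R).

(** K is the least non-decreasing path from 0 that stays above N. The last clause
    is the form in which minimality is used: K grows only by following N. *)
Definition skorokhod U K N : Prop :=
  [/\ K 0 = 0, forall s t, U s -> U t -> s <= t -> K s <= K t,
      forall t, U t -> N t <= K t
    & forall u v e, U u -> U v -> u <= v -> K u < K v -> 0 < e ->
      exists s, [/\ U s, u < s, s <= v & K v < N s + e]].

Lemma skorokhod_sub S U K N : initial_segment U -> U `<=` S ->
  skorokhod S K N -> skorokhod U K N.
Proof.
move=> [_ Upos Uconv] US [K0 Km NK Kmin]; split=> //.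
- by move=> s t /US Ss /US; exact: Km.
- by move=> t /US; exact: NK.
- move=> u v e Uu Uv uv Kuv e0.
  have [s [_ us sv h]] := Kmin u v e (US _ Uu) (US _ Uv) uv Kuv e0.
  exists s; split=> //; apply: Uconv Uv _.
  by rewrite sv andbT (le_trans (Upos _ Uu)) // ltW.
Qed.

(** An error that is a quarter of the smallest gap between the finitely many values
    of a path along a partition is negligible before each increment. *)
Lemma seq_gap (xs : seq R) : exists2 e, 0 < e &
  forall x y, x \in xs -> y \in xs -> x < y -> 4 * e <= y - x.
Proof.
have [e e0 he] : exists2 e : R, 0 < e &
    forall z, z \in [seq x - y | x <- xs, y <- xs] -> 0 < z -> e <= z.
  elim: [seq _ | _ <- _, _ <- _] => [|z l [e e0 he]]; first by exists 1.
  have [z0|z0] := ltP 0 z.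
    exists (Num.min e z); first by rewrite lt_min e0.
    move=> y; rewrite inE => /predU1P[->|yl] y0; rewrite ge_min ?lexx ?orbT //.
    by rewrite he.
  exists e => // y; rewrite inE => /predU1P[->|]; last exact: he.
  by rewrite ltNge z0.
exists (e / 4); first by rewrite divr_gt0.
move=> x y xx yx xy; have -> : 4 * (e / 4) = e by field.
by apply: he; [apply: allpairs_f|rewrite subr_gt0].
Qed.

Section Zigzag.
Variables (p V eta : R) (U : set R) (w : R -> R).
Hypotheses (p1 : 1 <= p) (V0 : 0 <= V) (eta0 : 0 < eta) (cw : control U w).
Let C := (2 * V) `^ p.

Let p0 : 0 < p. Proof. exact: lt_le_trans p1. Qed.
Let pn0 : p != 0. Proof. by rewrite gt_eqF. Qed.
Let C0 : 0 <= C. Proof. exact: powR_ge0. Qed.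

(** State of a left-to-right scan of the increments of [K - K'] in the middle
    of an increasing run: the run started from the value [a], reached at a time
    when the past has been paid for up to [c]. A turning point of the scan is
    bounded, up to [eta], by the value of [N - N'] at a time where the path that has
    just grown touches its obstacle. These times are in order, so that each run
    costs an increment of [N - N']. The case of a decreasing run is the same
    with the two problems exchanged. *)
Lemma zigzag (G : R -> Prop) K K' N N' l t a s s' c :
  skorokhod U K N -> skorokhod U K' N' ->
  ctrl_by p U w (fun r => N r - N' r) V ->
  (forall x y, G x -> G y -> x < y -> 4 * eta <= y - x) ->
  path <%R t l -> (forall r, r \in t :: l -> U r) ->
  (forall r, r \in t :: l -> G (K r - K' r)) -> G a ->
  a < K t - K' t -> U s' -> s < s' -> s' <= t ->
  K t - K' t <= N s' - N' s' + eta ->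
  (forall r b, U r -> s < r -> G b -> a < b -> b <= N r - N' r + eta ->
    (b - a) `^ p <= C * w r - c) ->
  (K t - K' t - a) `^ p +
    partition_sum (fun u v => `|(K v - K' v) - (K u - K' u)| `^ p) t l
  <= C - c.
Proof.
elim: l t a s s' c G K K' N N' => [|t1 l ih] t a s s' c G K K' N N'
    skK skK' Wc Ggap ptl Utl Gtl Ga at_ Us' ss' s't tW run.
  rewrite partition_sum_nil addr0.
  apply: le_trans (run s' _ Us' ss' (Gtl _ _) at_ tW) _; first by rewrite inE.
  rewrite lerD2r -[leRHS]mulr1 ler_wpM2l //.
  by have /andP[] := cw.1 _ Us'.
rewrite partition_sum_cons.
move: ptl => /= /andP[tt1 p1l].
have Ut : U t by apply: Utl; rewrite inE eqxx.
have Ut1 : U t1 by apply: Utl; rewrite !inE eqxx orbT.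
have Utl1 r : r \in t1 :: l -> U r by move=> h; apply: Utl; rewrite inE h orbT.
have Gtl1 r : r \in t1 :: l -> G (K r - K' r).
  by move=> h; apply: Gtl; rewrite inE h orbT.
have Gt : G (K t - K' t) by apply: Gtl; rewrite inE eqxx.
have [Kt0 Km NK Kmin] := skK; have [K't0 K'm NK' K'min] := skK'.
have Ktt1 := Km _ _ Ut Ut1 (ltW tt1); have K'tt1 := K'm _ _ Ut Ut1 (ltW tt1).
have [up|down] := leP (K t - K' t) (K t1 - K' t1).
  have -> : `|K t1 - K' t1 - (K t - K' t)| = K t1 - K' t1 - (K t - K' t).
    by rewrite ger0_norm // subr_ge0.
  have at1 : a < K t1 - K' t1 by exact: lt_le_trans up.
  have [s1 [Us1 ss1 s1t1 t1W]] : exists s1, [/\ U s1, s < s1, s1 <= t1 &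
      K t1 - K' t1 <= N s1 - N' s1 + eta].
    move: up; rewrite le_eqVlt => /predU1P[e|up].
      by exists s'; split=> //; [exact: le_trans (ltW tt1)|rewrite -e].
    have [|s1 [Us1 ts1 s1t1 h]] := Kmin t t1 eta Ut Ut1 (ltW tt1) _ eta0.
      by lra.
    exists s1; split=> //; first by rewrite (lt_trans ss') // (le_lt_trans s't).
    have := NK' _ Us1; have := K'm _ _ Us1 Ut1 s1t1; lra.
  have := ih t1 a s s1 c G K K' N N' skK skK' Wc Ggap p1l Utl1 Gtl1 Ga at1 Us1
    ss1 s1t1 t1W run.
  apply: le_trans; rewrite addrA lerD2r.
  have -> : K t1 - K' t1 - a =
    (K t - K' t - a) + (K t1 - K' t1 - (K t - K' t)) by ring.
  by apply: powR_superadd => //; lra.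
have K't : K' t < K' t1 by lra.
have [s1 [Us1 ts1 s1t1 h1]] := K'min t t1 eta Ut Ut1 (ltW tt1) K't eta0.
have t1W : K' t1 - K t1 <= N' s1 - N s1 + eta.
  by have := NK _ Us1; have := Km _ _ Us1 Ut1 s1t1; lra.
pose G' x := G (- x).
have h := ih t1 (K' t - K t) s' s1 (C * w s') G' K' K N' N skK' skK.
have {}h : (K' t1 - K t1 - (K' t - K t)) `^ p +
    partition_sum (fun u v => `|K' v - K v - (K' u - K u)| `^ p) t1 l
    <= C - C * w s'.
  apply: h => //.
  - by move=> u v Uu Uv uv; rewrite -normrN; apply: le_trans (Wc _ _ Uu Uv uv);
      rewrite le_eqVlt; apply/orP; left; apply/eqP; congr `|_|; ring.
  - by move=> x y Gx Gy xy; have := Ggap _ _ Gy Gx; rewrite ltrN2 => /(_ xy); lra.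
  - by move=> r rl; rewrite /G' opprB; exact: Gtl1.
  - by rewrite /G' opprB.
  - by lra.
  - exact: le_lt_trans ts1.
  move=> r b Ur s'r Gb tb bW.
  have gap : 4 * eta <= (K t - K' t) - - b by apply: Ggap => //; lra.
  have inc := Wc _ _ Us' Ur (ltW s'r).
  have le2 : b - (K' t - K t) <= 2 * V * (w r - w s') `^ p^-1.
    have := ler_norm (- (N r - N' r - (N s' - N' s'))); rewrite normrN; lra.
  have dw := control_diff cw Us' Ur (ltW s'r).
  rewrite -mulrBr -[X in _ * X](powRVK pn0); last lra.
  rewrite -powRM ?mulr_ge0 ?powR_ge0 //.
  by apply: powR_mono => //; [exact: ltW|lra].
have first_run := run s' _ Us' ss' Gt at_ tW.
have -> : `|K t1 - K' t1 - (K t - K' t)| = K' t1 - K t1 - (K' t - K t).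
  by rewrite ltr0_norm; lra.
have -> : partition_sum (fun u v => `|K v - K' v - (K u - K' u)| `^ p) t1 l =
    partition_sum (fun u v => `|K' v - K v - (K' u - K u)| `^ p) t1 l.
  apply: eq_bigr => i _; rewrite -normrN; congr (`|_| `^ _); ring.
lra.
Qed.

(** The first run of the scan starts from the value 0, which need not be close to a
    value of [N - N']; its cost is paid for by the size of [N - N']. *)
Lemma zigzag_start (G : R -> Prop) K K' N N' D l t :
  skorokhod U K N -> skorokhod U K' N' ->
  ctrl_by p U w (fun r => N r - N' r) V ->
  (forall x y, G x -> G y -> x < y -> 4 * eta <= y - x) ->
  path <%R t l -> (forall r, r \in t :: l -> U r) ->
  (forall r, r \in t :: l -> G (K r - K' r)) -> G 0 ->
  K t - K' t = 0 -> (forall r, U r -> 2 * `|N r - N' r| <= D) ->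
  partition_sum (fun u v => `|(K v - K' v) - (K u - K' u)| `^ p) t l
  <= C + D `^ p.
Proof.
move=> skK skK' Wc Ggap + + + G0 + WD.
have key t1 t2 l' (G' : R -> Prop) K1 K2 N1 N2 : skorokhod U K1 N1 ->
    skorokhod U K2 N2 ->
    ctrl_by p U w (fun r => N1 r - N2 r) V ->
    (forall x y, G' x -> G' y -> x < y -> 4 * eta <= y - x) ->
    path <%R t1 (t2 :: l') -> (forall r, r \in t1 :: t2 :: l' -> U r) ->
    (forall r, r \in t2 :: l' -> G' (K1 r - K2 r)) -> G' 0 ->
    K1 t1 - K2 t1 = 0 -> 0 < K1 t2 - K2 t2 ->
    (forall r, U r -> 2 * `|N1 r - N2 r| <= D) ->
    partition_sum (fun u v => `|(K1 v - K2 v) - (K1 u - K2 u)| `^ p) t1 (t2 :: l')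
    <= C + D `^ p.
  move=> sk1 sk2 Wc' Ggap' /= /andP[t12 p2] Ul Gl G'0 g1 g2 WD'.
  rewrite partition_sum_cons g1 subr0 gtr0_norm //.
  have Ut1 : U t1 by apply: Ul; rewrite inE eqxx.
  have Ut2 : U t2 by apply: Ul; rewrite !inE eqxx orbT.
  have [_ K1m _ K1min] := sk1; have [_ K2m NK2 _] := sk2.
  have [|s1 [Us1 ts1 s1t h]] := K1min t1 t2 eta Ut1 Ut2 (ltW t12) _ eta0.
    by have := K2m _ _ Ut1 Ut2 (ltW t12); lra.
  have s1W : K1 t2 - K2 t2 <= N1 s1 - N2 s1 + eta.
    by have := NK2 _ Us1; have := K2m _ _ Us1 Ut2 s1t; lra.
  have -> : C + D `^ p = C - - (D `^ p) by rewrite opprK.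
  rewrite -[K1 t2 - K2 t2]subr0.
  apply: (@zigzag G' K1 K2 N1 N2 l' t2 0 t1 s1 (- (D `^ p))) => //.
    by move=> r rl; apply: Ul; rewrite inE rl orbT.
  move=> r b Ur t1r Gb b0 bW; rewrite opprK subr0.
  apply: (@le_trans _ _ (D `^ p)); last first.
    by rewrite lerDr mulr_ge0 //; have /andP[] := cw.1 _ Ur.
  apply: powR_mono; [exact: ltW|exact: ltW|].
  apply: le_trans (WD' _ Ur).
  have := Ggap' _ _ G'0 Gb b0; have := ler_norm (N1 r - N2 r); lra.
elim: l t => [|t1 l ih] t ptl Utl Gtl gt0.
  by rewrite partition_sum_nil addr_ge0 // powR_ge0.
have Gtl1 r : r \in t1 :: l -> G (K r - K' r).
  by move=> h; apply: Gtl; rewrite inE h orbT.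
have [up|down|same] := ltgtP 0 (K t1 - K' t1).
- exact: key skK skK' Wc Ggap ptl Utl Gtl1 G0 gt0 up WD.
- have -> : partition_sum (fun u v => `|K v - K' v - (K u - K' u)| `^ p) t (t1 :: l) =
    partition_sum (fun u v => `|K' v - K v - (K' u - K u)| `^ p) t (t1 :: l).
    by apply: eq_bigr => i _; rewrite -normrN; congr (`|_| `^ _); ring.
  apply: (key t t1 l (fun x => G (- x)) K' K N' N) => //.
  + by move=> u v Uu Uv uv; rewrite -normrN; apply: le_trans (Wc _ _ Uu Uv uv);
      rewrite le_eqVlt; apply/orP; left; apply/eqP; congr `|_|; ring.
  + by move=> x y Gx Gy xy; have := Ggap _ _ Gy Gx; rewrite ltrN2 => /(_ xy); lra.
  + by move=> r rl; rewrite opprB; exact: Gtl1.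
  + by rewrite oppr0.
  + by lra.
  + by lra.
  + by move=> r Ur; rewrite distrC; exact: WD.
- rewrite partition_sum_cons gt0 -same subr0 normr0 powR0 // add0r.
  move: ptl => /= /andP[_ p1l]; apply: ih => //.
  by move=> r rl; apply: Utl; rewrite inE rl orbT.
Qed.

End Zigzag.

(** The scan of any partition costs the variation of [N - N'] and, for its first
    run, the size of [N - N']. *)
Lemma skorokhod_lipschitz p U K K' N N' V :
  1 <= p -> 0 < V -> initial_segment U ->
  skorokhod U K N -> skorokhod U K' N' ->
  ctrl p U (fun r => N r - N' r : R^o) V ->
  ctrl p U (fun r => K r - K' r : R^o) (4 * (`|N 0 - N' 0| + V)).
Proof.
move=> p1 V0 U0 skK skK' cN; have [w cw bw] := cN.
have [U00 Upos Uconv] := U0.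
(* A bound for 2 |N - N'| on U. *)
set D := 2 * (`|N 0 - N' 0| + V).
have D0 : 0 < D by rewrite /D mulr_gt0 // ltr_wpDl.
apply: ctrl_of_sums => //; first by rewrite mulr_gt0 // ltr_wpDl.
move=> t s Ut [pts /eqP lts].
have Us r : r \in 0 :: s -> U r.
  by move=> /(path_lt_mem pts); rewrite lts; exact: Uconv.
have [eta eta0 gap] := seq_gap (0 :: [seq K r - K' r | r <- 0 :: s]).
apply: (@le_trans _ _ ((2 * V) `^ p + D `^ p)); last first.
  apply: le_trans (powR_superadd p1 _ _) _; [by lra|exact: ltW|].
  have N0 := normr_ge0 (N 0 - N' 0).
  by apply: powR_mono; rewrite /D; lra.
apply: (@zigzag_start p V eta U w p1 (ltW V0) eta0 cw
  (fun x => x \in 0 :: [seq K r - K' r | r <- 0 :: s]) K K' N N' D s 0) => //.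
- move=> r rs; rewrite inE; apply/orP; right.
  exact: (map_f (fun r => K r - K' r)).
- by rewrite inE eqxx.
- by have [-> _ _ _] := skK; have [-> _ _ _] := skK'; rewrite subr0.
- move=> r Ur; rewrite /D ler_pM2l //.
  have h := ctrl_osc p1 (ltW V0) cN U00 Ur (Upos _ Ur).
  have -> : N r - N' r = (N 0 - N' 0) + (N r - N' r - (N 0 - N' 0)) by ring.
  by apply: le_trans (ler_normD _ _) _; rewrite lerD2l.
Qed.

End Skorokhod.

(** * Stability on the whole interval, block by block *)

Section CoordinateControls.
Context {R : realType}.

(** The mean of the controls of the coordinates controls the vector. *)
Lemma ctrl_coords r (S : set R) n (Z : R -> 'rV[R]_n) (V : R) :
  1 <= r -> 0 <= V -> (forall i, ctrl r S (fun t => Z t 0 i : R^o) V) ->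
  ctrl r S Z (n%:R * V).
Proof.
move=> r1 V0 /(_ _)/cid2 h.
have [w' hw'] : exists w' : 'I_n -> R -> R, forall i, control S (w' i) /\
    ctrl_by r S (w' i) (fun t => Z t 0 i : R^o) V.
  by exists (fun i => s2val (h i)) => i; case: (h i).
case: n Z h w' hw' => [|n] Z _ w' hw'.
  apply: ctrl_const => [|u v _ _]; first by rewrite mul0r.
  by apply/rowP => -[].
have n0 : 0 < n.+1%:R :> R by rewrite ltr0n.
have sum_diff u v : (\sum_i w' i v) / n.+1%:R - (\sum_i w' i u) / n.+1%:R =
    (\sum_i (w' i v - w' i u)) / n.+1%:R by rewrite -mulrBl sumrB.
exists (fun t => (\sum_i w' i t) / n.+1%:R); first split.
- move=> t St; rewrite divr_ge0 ?sumr_ge0 ?(ltW n0) //=; last first.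
    by move=> i _; have /andP[] := (hw' i).1.1 _ St.
  rewrite ler_pdivrMr // mul1r -[X in X%:R]card_ord -sumr_const.
  by apply: ler_sum => i _; have /andP[] := (hw' i).1.1 _ St.
- move=> u v Su Sv uv; rewrite ler_pM2r ?invr_gt0 //.
  by apply: ler_sum => i _; exact: (hw' i).1.2.
move=> u v Su Sv uv; rewrite sum_diff.
set D := \sum_i _.
have di i : 0 <= w' i v - w' i u by have /andP[] := control_diff (hw' i).1 Su Sv uv.
have D0 : 0 <= D / n.+1%:R by rewrite divr_ge0 ?sumr_ge0 ?(ltW n0).
apply: mx_norm_le => [|j i]; first by rewrite !mulr_ge0 ?powR_ge0 // ltW.
rewrite ord1 !mxE; have := (hw' i).2 _ _ Su Sv uv => /le_trans; apply.
rewrite [n.+1%:R * V]mulrC -mulrA ler_wpM2l //.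
apply: le_trans (powR_inv_scale r1 _ D0); last by rewrite ler1n.
rewrite mulrC divfK ?gt_eqF //; apply: powR_mono => //.
  by rewrite invr_ge0 (le_trans _ r1).
by rewrite /D (bigD1 i) //= lerDl sumr_ge0.
Qed.

End CoordinateControls.

Section Stability.
Context {R : realType}.
Variables (n d : nat) (p q b M V' : R).
Hypotheses (q1 : 1 <= q) (qp : q <= p) (pq : 1 < p^-1 + q^-1).
Hypotheses (b0 : 0 <= b) (M0 : 0 <= M) (V'0 : 0 <= V').

Let p1 : 1 <= p. Proof. exact: le_trans qp. Qed.

(** The third bound is what a bounded second derivative is needed for: with it, the
    variation of f(Y) - f(Y'), and not only its size, is of the order of Y - Y'. *)
Definition second_order_bound (f : 'rV[R]_n -> 'M[R]_(d, n)) : Prop :=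
  [/\ forall x, `|f x| <= b, forall x y, `|f x - f y| <= b * `|x - y|
    & forall x x' h, `|(f (x + h) - f x) - (f (x' + h) - f x')|
                     <= b * `|h| * `|x - x'|].

Definition skorokhod_const : R := 64 * n%:R + 4.
Definition sum_const : R := young_const d p q * (3 * b * (1 + V')).
Definition block_const : R :=
  3 * (8 + sum_const * (M + 5) + d%:R * (b * (M + 1))).

Let sk := skorokhod_const.
Let cR := sum_const.
Let cB := block_const.

Let sk0 : 0 <= sk. Proof. by rewrite addr_ge0 // mulr_ge0. Qed.
Let cR0 : 0 <= cR.
Proof. by rewrite mulr_ge0 ?young_const_ge0 // mulr_ge0 ?addr_ge0 // mulr_ge0. Qed.
Let cB0 : 0 <= cB.
Proof.
have h1 : 0 <= cR * (M + 5) by rewrite mulr_ge0 // addr_ge0.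
have h2 : 0 <= d%:R * (b * (M + 1)) by rewrite mulr_ge0 // mulr_ge0 // addr_ge0.
by rewrite /cB /block_const -/cR; lra.
Qed.

(** The variation of A that makes the feedback of I - I' through the Skorokhod map
    at most one half. *)
Definition small_variation : R := (12 * (skorokhod_const * sum_const) + 1)^-1.
Definition block_count : nat := (Num.truncn ((M / small_variation) `^ q)).+1.
Definition step_const : R := 3 * skorokhod_const * (1 + block_const).
(** The bound after [i] blocks, in units of the distance of the data. *)
Definition growth (i : nat) : R := iter i (fun c => step_const * (1 + c)) 0.

Let nu := small_variation.
Let Nb := block_count.

Let small_props : [/\ 0 < nu, nu <= 1 & sk * (6 * cR * nu) <= 2^-1].
Proof.
have h : 0 <= sk * cR by rewrite mulr_ge0.
have h1 : 0 < 12 * (sk * cR) + 1 by lra.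
split; first by rewrite invr_gt0.
  by rewrite /nu /small_variation -/sk -/cR invf_le1 //; lra.
have -> : sk * (6 * cR * nu) = (6 * (sk * cR)) / (12 * (sk * cR) + 1).
  by rewrite /nu /small_variation -/sk -/cR; ring.
by rewrite ler_pdivrMr //; lra.
Qed.

Let Nb0 : 0 < Nb%:R :> R. Proof. by rewrite ltr0n. Qed.

Let M_block : M * Nb%:R^-1 `^ q^-1 <= nu.
Proof.
have [mu0 _ _] := small_props.
have q0 : 0 < q by rewrite (lt_le_trans _ q1).
have h : M / nu <= Nb%:R `^ q^-1.
  have Mm : 0 <= M / nu by rewrite divr_ge0 // ltW.
  rewrite -[leLHS](@powRKV R q) ?gt_eqF //; apply: powR_mono.
  - by rewrite invr_ge0 ltW.
  - exact: powR_ge0.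
  - exact: ltW (truncnS_gt _).
rewrite ler_pdivrMr // in h.
apply: le_trans (ler_wpM2r (powR_ge0 _ _) h) _.
rewrite mulrAC -powRM ?invr_ge0 ?(ltW Nb0) // divff ?gt_eqF //.
by rewrite (congr1 (@^~ q^-1) (powR1 R)) mul1r.
Qed.

Let step0 : 0 <= step_const.
Proof. by apply: mulr_ge0 (mulr_ge0 _ sk0) (addr_ge0 _ cB0). Qed.

Lemma growth_ge0 i : 0 <= growth i.
Proof. by elim: i => //= i ih; rewrite mulr_ge0 // addr_ge0. Qed.

Section Data.
Variables (T eps : R) (f : 'rV[R]_n -> 'M[R]_(d, n)) (y y' : 'rV[R]_n).
Variables (A A' : R -> 'rV[R]_d) (X X' L L' Y Y' K K' I I' : R -> 'rV[R]_n).
Hypotheses (T0 : 0 < T) (eps0 : 0 < eps) (fb : second_order_bound f).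
Hypothesis eqY : forall t : R, 0 <= t <= T -> Y t = y + I t + X t + K t.
Hypothesis eqY' : forall t : R, 0 <= t <= T -> Y' t = y' + I' t + X' t + K' t.
Hypotheses (I0 : I 0 = 0) (I'0 : I' 0 = 0) (X0 : X 0 = X' 0).

Let Xi (u v : R) : 'rV[R]_n := (A v - A u) *m (f (Y u) - f (Y' u)) +
  ((A v - A' v) - (A u - A' u)) *m f (Y' u).

Hypothesis approx : forall u v e : R, 0 <= u -> u <= v -> v <= T -> 0 < e ->
  exists2 s, itv_partition u v s &
    `|((I v - I' v) - (I u - I' u)) - partition_sum Xi u s| <= e.
Hypothesis skK : forall i, skorokhod `[0, T] (fun t => K t 0 i)
  (fun t => L t 0 i - (Y t 0 i - K t 0 i)).
Hypothesis skK' : forall i, skorokhod `[0, T] (fun t => K' t 0 i)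
  (fun t => L' t 0 i - (Y' t 0 i - K' t 0 i)).
Hypotheses (ye : `|y - y'| <= eps) (Le : `|L 0 - L' 0| <= eps).
Hypothesis cA : ctrl q `[0, T] A M.
Hypothesis cAA : ctrl q `[0, T] (fun t => A t - A' t) eps.
Hypothesis cXX : ctrl p `[0, T] (fun t => X t - X' t) eps.
Hypothesis cLL : ctrl p `[0, T] (fun t => L t - L' t) eps.
Hypothesis cY' : ctrl p `[0, T] Y' V'.

Let D (t : R) : 'rV[R]_n := Y t - Y' t.
Let kap (t : R) : 'rV[R]_n := K t - K' t.
Let J (t : R) : 'rV[R]_n := I t - I' t.

Let T01 (U : set R) t : U `<=` `[0, T] -> U t -> 0 <= t <= T.
Proof. by move=> UT /UT; rewrite /= in_itv. Qed.

Let K00 : K 0 = 0.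
Proof. by apply/rowP => i; have [-> _ _ _] := skK i; rewrite mxE. Qed.
Let K'00 : K' 0 = 0.
Proof. by apply/rowP => i; have [-> _ _ _] := skK' i; rewrite mxE. Qed.

Let T00 : 0 <= (0 : R) <= T. Proof. by rewrite lexx ltW. Qed.

Let D0 : `|D 0| <= eps.
Proof.
rewrite /D eqY // eqY' // I0 I'0 K00 K'00 X0 !addr0.
by rewrite opprD addrACA subrr addr0.
Qed.

Let DE t : 0 <= t <= T -> D t = (y - y') + J t + (X t - X' t) + kap t.
Proof.
move=> tT; rewrite /D /J /kap eqY // eqY' //.
by apply/rowP => i; rewrite !mxE; ring.
Qed.

(** The free parts of Y and Y' differ by the data and I - I', and the Skorokhod map
    turns this into a bound on K - K', hence on Y - Y'. *)
Lemma reflection_bound (U : set R) (V : R) : 0 <= V -> initial_segment U -> U `<=` `[0, T] ->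
  ctrl p U J V ->
  ctrl p U D (sk * (eps + V)) /\ ctrl p U kap (sk * (eps + V)).
Proof.
move=> V0 iU UT cJ.
have ep := eps0; have e0 := ltW eps0.
have cXU := ctrl_sub UT cXX; have cLU := ctrl_sub UT cLL.
have [U0 Upos _] := iU.
pose P t := J t + (X t - X' t).
have cP : ctrl p U P (2 * (V + eps)).
  apply: ctrl_add cJ cXU => // u v _ _ _.
  by rewrite /P; apply/rowP => i; rewrite !mxE; ring.
have ck : ctrl p U kap (n%:R * (4 * (2 * eps + 2 * (eps + 2 * (V + eps))))).
  apply: ctrl_coords => [//||i]; first lra.
  have sK := skorokhod_sub iU UT (skK i); have sK' := skorokhod_sub iU UT (skK' i).
  have NE t : U t -> (L t 0 i - (Y t 0 i - K t 0 i)) - (L' t 0 i - (Y' t 0 i - K' t 0 i))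
      = (L t - L' t) 0 i - (y - y') 0 i - P t 0 i.
    move=> /(T01 UT) tT; rewrite eqY // eqY' // /P /J !mxE; ring.
  have cN : ctrl p U (fun t => (L t 0 i - (Y t 0 i - K t 0 i))
      - (L' t 0 i - (Y' t 0 i - K' t 0 i)) : R^o) (2 * (1 * eps + 1 * (2 * (V + eps)))).
    apply: ctrl_dom2 cLU cP => //; first lra.
    move=> u v Uu Uv uv; rewrite !NE // !mul1r.
    have -> : (L v - L' v) 0 i - (y - y') 0 i - P v 0 i
        - ((L u - L' u) 0 i - (y - y') 0 i - P u 0 i)
      = (L v - L' v - (L u - L' u)) 0 i - (P v - P u) 0 i by rewrite !mxE; ring.
    by apply: le_trans (ler_normB _ _) _; apply: lerD; exact: mx_norm_entry.
  have V1 : 0 < 2 * (1 * eps + 1 * (2 * (V + eps))) by lra.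
  have N0 : `|L 0 0 i - (Y 0 0 i - K 0 0 i) - (L' 0 0 i - (Y' 0 0 i - K' 0 0 i))|
      <= 2 * eps.
    rewrite NE // /P /J I0 I'0 X0 !subrr addr0 [X in _ - X]mxE subr0.
    apply: le_trans (ler_normB _ _) _.
    have := le_trans (mx_norm_entry (L 0 - L' 0) 0 i) Le.
    have := le_trans (mx_norm_entry (y - y') 0 i) ye.
    lra.
  move: (skorokhod_lipschitz p1 V1 iU sK sK' cN); rewrite !mul1r.
  have -> : (fun t => kap t 0 i : R^o) = (fun t => K t 0 i - K' t 0 i).
    by apply/funext => t; rewrite !mxE.
  by apply: ctrl_le; lra.
have kV : 0 <= n%:R * (4 * (2 * eps + 2 * (eps + 2 * (V + eps)))).
  by rewrite mulr_ge0 //; lra.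
have nV : 0 <= n%:R * V by rewrite mulr_ge0.
have ne : 0 <= n%:R * eps by rewrite mulr_ge0.
split; last by apply: ctrl_le ck; rewrite /sk /skorokhod_const; lra.
apply: ctrl_le (ctrl_add p1 kV _ _ ck cP); [|lra|].
  rewrite /sk /skorokhod_const; lra.
move=> u v /(T01 UT) uT /(T01 UT) vT _; rewrite !DE // /P.
by apply/rowP => i; rewrite !mxE; ring.
Qed.

(* The first term moves D = Y - Y' with Y' fixed, the second moves Y' with D fixed. *)
Let fD u v : `|(f (Y v) - f (Y' v)) - (f (Y u) - f (Y' u))| <=
  b * `|D v - D u| + b * `|D u| * `|Y' v - Y' u|.
Proof.
have [_ f1 f2] := fb.
have YE t : Y t = Y' t + D t by rewrite /D addrC subrK.
have -> : f (Y v) - f (Y' v) - (f (Y u) - f (Y' u)) =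
    (f (Y' v + D v) - f (Y' v + D u)) +
    ((f (Y' v + D u) - f (Y' v)) - (f (Y' u + D u) - f (Y' u))).
  by rewrite -!YE; apply/matrixP => i j; rewrite !mxE; ring.
apply: le_trans (ler_normD _ _) _; apply: lerD; last exact: f2.
by apply: le_trans (f1 _ _) _; rewrite opprD addrACA subrr add0r.
Qed.

Let cDf S V : 0 <= V -> S `<=` `[0, T] -> ctrl p S D V ->
  (forall t, S t -> `|D t| <= eps + V) ->
  ctrl p S (fun t => f (Y t) - f (Y' t)) (2 * (b * V + b * (eps + V) * V')).
Proof.
move=> Vp ST cD Dle; have e0 := ltW eps0.
have cYS := ctrl_sub ST cY'.
apply: ctrl_dom2 cD cYS => //.
  by rewrite mulr_ge0 // addr_ge0.
move=> u v Su Sv uv; apply: le_trans (fD u v) _.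
by rewrite lerD2l ler_wpM2r // ler_wpM2l // Dle.
Qed.

(** The unknown V enters multiplied by the variation of A, so that it can be absorbed
    on a block where A varies little. *)
Lemma riemann_difference S V VA : 0 <= V -> 0 <= VA -> S `<=` `[0, T] ->
  ctrl p S D V -> (forall t, S t -> `|D t| <= eps + V) -> ctrl q S A VA ->
  exists2 w, control S w & forall a s,
    path <%R a s -> (forall t, t \in a :: s -> S t) ->
    `|partition_sum Xi a s| <=
      cR * (VA * (eps + V) + eps) * (w (last a s) - w a) `^ p^-1.
Proof.
move=> Vp VAp ST cD Dle cAS; have e0 := ltW eps0; have b0' := b0.
have [fb0 f1 f2] := fb.
have eV : 0 <= eps + V by rewrite addr_ge0.
have beV : 0 <= b * (eps + V) by rewrite mulr_ge0.
have bV' : 0 <= b * V' by rewrite mulr_ge0.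
have VH : 0 <= 2 * (b * V + b * (eps + V) * V').
  by rewrite mulr_ge0 // addr_ge0 // mulr_ge0.
have cG : ctrl p S (fun t => f (Y' t)) (b * V').
  by apply: ctrl_dom (ctrl_sub ST cY') => // u v _ _ _; exact: f1.
have H0 t : S t -> `|f (Y t) - f (Y' t)| <= b * (eps + V).
  by move=> St; apply: le_trans (f1 _ _) _; rewrite ler_wpM2l // Dle.
have [w cw hw] := riemann_sum_ctrl q1 qp pq VH bV' VAp e0 beV b0
  (cDf Vp ST cD Dle) cG cAS (ctrl_sub ST cAA) H0 (fun t _ => fb0 _).
exists w => // a s pas Sas; apply: le_trans (hw a s pas Sas) _.
rewrite ler_wpM2r ?powR_ge0 // /cR /sum_const -[leRHS]mulrA.
rewrite ler_wpM2l ?young_const_ge0 //.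
have VAe : 0 <= VA * (eps + V) by rewrite mulr_ge0.
have -> : 3 * b * (1 + V') * (VA * (eps + V) + eps) =
    VA * (3 * (b * (eps + V)) + 3 * (b * (eps + V) * V')) + eps * (3 * b + 3 * (b * V')).
  by ring.
apply: lerD; apply: ler_wpM2l => //; last lra.
have bV : 0 <= b * V by rewrite mulr_ge0.
have be : 0 <= b * eps by rewrite mulr_ge0.
have bVV : 0 <= b * (eps + V) * V' by rewrite mulr_ge0.
lra.
Qed.

Let approx_le u v c : 0 <= u -> u <= v -> v <= T ->
  (forall s, itv_partition u v s -> `|partition_sum Xi u s| <= c) ->
  `|J v - J u| <= c.
Proof.
move=> u0 uv vT h; apply/ler_addgt0Pr => e e0.
have [s ps hs] := approx u0 uv vT e0.
rewrite -[J v - J u](subrK (partition_sum Xi u s)) addrC.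
by apply: le_trans (ler_normD _ _) _; apply: lerD => //; exact: h.
Qed.

(** Increments of I - I' inside U are read off the equation, and inside Q they are
    small because A is. For an increment from U to Q, a partition is cut after its
    last point in U: in the term of the cut, the integrand is evaluated in U, so that
    the unknown V enters only through Q. *)
Lemma block_bound (U Q : set R) (mu Vu V : R) :
  initial_segment U -> initial_segment (U `|` Q) -> U `|` Q `<=` `[0, T] ->
  (forall u v, U u -> Q v -> u < v) ->
  0 <= mu -> mu <= 1 -> ctrl q Q A mu ->
  0 <= Vu -> ctrl p U D Vu -> ctrl p U kap Vu ->
  0 <= V -> ctrl p (U `|` Q) D V ->
  ctrl p (U `|` Q) J (cB * (eps + Vu) + 6 * cR * mu * V).
Proof.
move=> iU iUQ UQT UQ mu0 mu1 cAQ Vu0 cDU ckU Vp cDV.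
have e0 := ltW eps0; have b0' := b0; have M0' := M0; have cR0' := cR0.
have [U0 Upos Uconv] := iU; have [_ UQpos UQconv] := iUQ.
have UT : U `<=` `[0, T] by move=> t Ut; apply: UQT; left.
have QT : Q `<=` `[0, T] by move=> t Qt; apply: UQT; right.
have DU t : U t -> `|D t| <= eps + Vu.
  move=> Ut; rewrite -(subrK (D 0) (D t)) addrC.
  apply: le_trans (ler_normD _ _) _; apply: lerD => //.
  exact: ctrl_osc p1 Vu0 cDU U0 Ut (Upos _ Ut).
have DQ t : Q t -> `|D t| <= eps + V.
  move=> Qt; rewrite -(subrK (D 0) (D t)) addrC.
  apply: le_trans (ler_normD _ _) _; apply: lerD => //.
  by apply: ctrl_osc p1 Vp cDV _ _ (UQpos _ _); [left|right|right].
have cDQ : ctrl p Q D V by apply: ctrl_sub cDV => t; right.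
have [wQ cwQ hQ] := riemann_difference Vp mu0 QT cDQ DQ cAQ.
have [wU cwU hU] := riemann_difference Vu0 M0 UT cDU DU (ctrl_sub UT cA).
set RQ := cR * (mu * (eps + V) + eps) in hQ.
set RU := cR * (M * (eps + Vu) + eps) in hU.
have RQ0 : 0 <= RQ by rewrite mulr_ge0 // addr_ge0 // mulr_ge0 // addr_ge0.
have RU0 : 0 <= RU by rewrite mulr_ge0 // addr_ge0 // mulr_ge0 // addr_ge0.
pose RX := d%:R * (b * (M + 1)) * (eps + Vu).
have RX0 : 0 <= RX by rewrite !(mulr_ge0, addr_ge0).
have cJU : ctrl p U J (8 * (eps + Vu)).
  have c1 : ctrl p U (fun t => D t - kap t) (2 * (1 * Vu + 1 * Vu)).
    apply: ctrl_dom2 cDU ckU => // u v _ _ _; rewrite !mul1r.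
    have -> : D v - kap v - (D u - kap u) = (D v - D u) - (kap v - kap u).
      by apply/rowP => i; rewrite !mxE; ring.
    exact: ler_normB.
  have c2 : ctrl p U J (2 * (1 * (2 * (1 * Vu + 1 * Vu)) + 1 * eps)).
    apply: ctrl_dom2 c1 (ctrl_sub UT cXX) => //; first lra.
    move=> u v /(T01 UT) uT /(T01 UT) vT _; rewrite !mul1r.
    have -> : J v - J u = (D v - kap v - (D u - kap u)) -
        (X v - X' v - (X u - X' u)).
      by rewrite !DE //; apply/rowP => i; rewrite !mxE; ring.
    exact: ler_normB.
  by apply: ctrl_le c2; lra.
have rootle w S' u v : control S' w -> S' u -> S' v -> u <= v ->
    (w v - w u) `^ p^-1 <= 1.
  move=> cw Su Sv uv; apply: powR_le1; first by rewrite invr_ge0 (le_trans _ p1).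
  exact: control_diff cw Su Sv uv.
have cJQ : ctrl p Q J RQ.
  exists wQ => // u v Qu Qv uv.
  have /andP[u0 _] := T01 QT Qu; have /andP[_ vT] := T01 QT Qv.
  apply: approx_le => // s [ps /eqP ls]; rewrite -ls; apply: hQ => // t ts.
  have /andP[ut tv] := path_lt_mem ps ts; rewrite ls in tv.
  have [Ut|//] : (U `|` Q) t.
    by apply: (UQconv t v); [right|rewrite (le_trans u0)].
  by have := UQ _ _ Ut Qu; rewrite ltNge ut.
have cross u v : U u -> Q v -> `|J v - J u| <= RU + RX + RQ.
  move=> Uu Qv; have /andP[u0 _] := T01 UT Uu; have /andP[_ vT] := T01 QT Qv.
  apply: approx_le => //; first exact: ltW (UQ _ _ Uu Qv).
  move=> s [ps /eqP ls].
  have sUQ t : t \in u :: s -> (U `|` Q) t.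
    move=> /(path_lt_mem ps); rewrite ls => /andP[ut tv].
    by apply: (UQconv t v); [right|rewrite (le_trans u0)].
  have nUv : ~ U (last u s) by rewrite ls => /UQ/(_ Qv); rewrite ltxx.
  have [s1 [t [s2 [es s1U nUt]]]] : exists s1 t s2,
      [/\ s = s1 ++ t :: s2, forall r, r \in u :: s1 -> U r & ~ U t].
    elim: s u Uu nUv {ps ls sUQ u0} => [//|x s ih] u Uu nUv.
    have [Ux|nUx] := pselect (U x).
      have [s1 [t [s2 [-> h1 h2]]]] := ih x Ux nUv.
      exists (x :: s1), t, s2; split=> // r; rewrite inE => /predU1P[->//|].
      exact: h1.
    by exists [::], x, s; split=> // r; rewrite inE => /eqP ->.
  move: ps; rewrite es cat_path /= => /and3P[p1' xt p2'].
  set x := last u s1 in xt.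
  have Ux : U x by apply: s1U; exact: mem_last.
  have Qs2 r : r \in t :: s2 -> Q r.
    move=> rs; have [Ur|//] : (U `|` Q) r.
      by apply: sUQ; rewrite es inE mem_cat rs !orbT.
    case: nUt; apply: Uconv Ur _.
    have /andP[-> _] := path_lt_mem p2' rs.
    by rewrite andbT (le_trans (Upos _ Ux)) // ltW.
  have Qt : Q t by apply: Qs2; rewrite inE eqxx.
  rewrite partition_sum_cat partition_sum_cons -/x addrA.
  apply: le_trans (ler_normD _ _) _; apply: lerD; last first.
    apply: le_trans (hQ _ _ p2' Qs2) _; rewrite ler_piMr //.
    by apply: rootle cwQ _ _ _ => //; [apply: Qs2; exact: mem_last|exact: path_last_le].
  apply: le_trans (ler_normD _ _) _; apply: lerD.
    apply: le_trans (hU _ _ p1' s1U) _; rewrite ler_piMr //.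
    by apply: rootle cwU _ _ _ => //; exact: path_last_le.
  have [fb0 f1 _] := fb.
  have Txl : `[0, T]%classic x by exact: UT.
  have Ttl : `[0, T]%classic t by exact: QT.
  have dA := ctrl_osc q1 M0 cA Txl Ttl (ltW xt).
  have dAA := ctrl_osc q1 e0 cAA Txl Ttl (ltW xt).
  have H0 : `|f (Y x) - f (Y' x)| <= b * (eps + Vu).
    by apply: le_trans (f1 _ _) _; rewrite ler_wpM2l // DU.
  have beV : 0 <= b * (eps + Vu) by rewrite mulr_ge0 // addr_ge0.
  apply: le_trans (ler_normD _ _) _.
  apply: (@le_trans _ _ (d%:R * M * (b * (eps + Vu)) + d%:R * eps * b)).
    by apply: lerD; (apply: le_trans (mx_norm_mul _ _) _; apply: ler_pM;
      rewrite ?mulr_ge0 ?ler_wpM2l //).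
  rewrite /RX -!mulrA -mulrDr ler_wpM2l //.
  have bVu : 0 <= b * Vu by rewrite mulr_ge0.
  have -> : b * ((M + 1) * (eps + Vu)) =
    M * (b * (eps + Vu)) + eps * b + b * Vu by ring.
  by rewrite lerDl.
have cJ : ctrl p (U `|` Q) J (3 * (8 * (eps + Vu) + RQ + (RU + RX + RQ))).
  by apply: (ctrl_glue p1 _ RQ0 _ UQ cross cJU cJQ); lra.
apply: ctrl_le cJ.
have ce : 0 <= cR * eps by rewrite mulr_ge0.
have cmu : cR * (mu * eps) <= cR * eps.
  by rewrite ler_wpM2l // ler_piMl.
have cVu : 0 <= cR * Vu by rewrite mulr_ge0.
have cMVu : 0 <= cR * (M * Vu) by rewrite mulr_ge0 // mulr_ge0.
rewrite /cB /block_const -/cR /RQ /RU -/RX.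
have -> : 3 * (8 + cR * (M + 5) + d%:R * (b * (M + 1))) * (eps + Vu)
   + 6 * cR * mu * V =
   3 * (8 * (eps + Vu) + cR * (M * (eps + Vu)) + 5 * (cR * eps) + 5 * (cR * Vu) + RX
     + 2 * (cR * (mu * V))) by rewrite /RX; ring.
have -> : cR * (mu * (eps + V) + eps) = cR * (mu * eps) + cR * (mu * V) + cR * eps.
  by ring.
have -> : cR * (M * (eps + Vu) + eps) = cR * (M * (eps + Vu)) + cR * eps by ring.
lra.
Qed.

Hypothesis cD : exists2 V, 0 <= V & ctrl p `[0, T] D V.

(** The new bound on [Y - Y'] contains only a small multiple of the old one, and
    can be absorbed; this is where A has to be small on the block. *)
Lemma block_step (U Q : set R) (Vu : R) :
  initial_segment U -> initial_segment (U `|` Q) -> U `|` Q `<=` `[0, T] ->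
  (forall u v, U u -> Q v -> u < v) -> ctrl q Q A nu ->
  0 <= Vu -> ctrl p U D Vu -> ctrl p U kap Vu ->
  ctrl p (U `|` Q) D (step_const * (eps + Vu)) /\
  ctrl p (U `|` Q) kap (step_const * (eps + Vu)).
Proof.
move=> iU iUQ UQT UQ cAQ Vu0 cDU ckU.
have [mu0 mu1 mus] := small_props; have e0 := eps0.
have sk4 : 4 <= sk by rewrite /sk /skorokhod_const lerDr mulr_ge0.
set a := sk * (eps + cB * (eps + Vu)).
have h1 : 0 <= cB * (eps + Vu) by rewrite mulr_ge0 // addr_ge0 // ltW.
have a0 : 0 < a by rewrite mulr_gt0 //; lra.
have stepV V : 0 <= V -> ctrl p (U `|` Q) D V ->
    ctrl p (U `|` Q) D (a + V / 2) /\ ctrl p (U `|` Q) kap (a + V / 2).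
  move=> V0 cDV.
  have cJ := block_bound iU iUQ UQT UQ (ltW mu0) mu1 cAQ Vu0 cDU ckU V0 cDV.
  have VJ0 : 0 <= cB * (eps + Vu) + 6 * cR * nu * V.
    by rewrite addr_ge0 // mulr_ge0 // mulr_ge0 ?(ltW mu0) // mulr_ge0.
  have [c1 c2] := reflection_bound VJ0 iUQ UQT cJ.
  have le : sk * (eps + (cB * (eps + Vu) + 6 * cR * nu * V)) <= a + V / 2.
    have -> : sk * (eps + (cB * (eps + Vu) + 6 * cR * nu * V)) =
      a + (sk * (6 * cR * nu)) * V by rewrite /a; ring.
    by rewrite lerD2l mulrC ler_wpM2l.
  by split; [exact: ctrl_le le c1|exact: ctrl_le le c2].
have [V0 V00 cDV0] := cD.
have cD3 : ctrl p (U `|` Q) D (3 * a).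
  apply: (ctrl_absorb a0 V00 (ctrl_sub UQT cDV0)) => V Vp /(stepV _ Vp)[].
  by [].
have [|_ ck] := stepV _ _ cD3; first lra.
have le : 3 * a <= step_const * (eps + Vu).
  have -> : step_const * (eps + Vu) = 3 * a + 3 * sk * Vu.
    by rewrite /step_const /a -/sk -/cB; ring.
  by rewrite lerDl mulr_ge0 // mulr_ge0.
split; first exact: ctrl_le le cD3.
by apply: ctrl_le ck; apply: le_trans le; lra.
Qed.

(** Cutting [0, T] into blocks along a control of A, rather than at jump times,
    gives a number of blocks that depends on M only. A jump of A between two
    blocks is harmless, as its integrand is evaluated before the jump. *)
Lemma stability_by_blocks :
  ctrl p `[0, T] D (growth Nb.+1 * eps) /\ ctrl p `[0, T] kap (growth Nb.+1 * eps).
Proof.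
have e0 := eps0; have [w cw bw] := cA.
pose U i := [set t | `[0, T]%classic t /\ (t = 0 \/ w t < i%:R / Nb%:R)].
pose Q i := [set t | [/\ `[0, T]%classic t, t != 0, i%:R / Nb%:R <= w t
  & w t < i.+1%:R / Nb%:R]].
have T0' : `[0, T]%classic 0 by rewrite /= in_itv.
have Tpos t : `[0, T]%classic t -> 0 <= t by rewrite /= in_itv => /andP[].
have UT i : U i `<=` `[0, T] by move=> t [].
have iU i : initial_segment (U i).
  split; [by split=> //; left|by move=> t /UT/Tpos|].
  move=> s t [Tt ht] /andP[s0 st].
  have Ts : `[0, T]%classic s.
    by move: Tt; rewrite /= !in_itv /= s0 => /andP[_]; exact: le_trans.
  split=> //; case: ht => [t0|wt].
    by left; apply/eqP; rewrite eq_le s0 andbT -t0.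
  by right; apply: le_lt_trans wt; exact: cw.2.
have lt_i i : i%:R / Nb%:R < i.+1%:R / Nb%:R :> R.
  by rewrite ltr_pM2r ?invr_gt0 // ltr_nat.
have UQ i : U i.+1 = U i `|` Q i.
  apply/seteqP; split=> [t [Tt ht]|t [[Tt [->|wt]]|[Tt t0 w1 w2]]].
  - have [t0|t0] := eqVneq t 0; first by left; split=> //; left.
    case: ht => [/eqP|wt]; first by rewrite (negPf t0).
    by have [h|h] := ltP (w t) (i%:R / Nb%:R); [left; split=> //; right|right; split].
  - by split=> //; left.
  - by split=> //; right; exact: lt_trans (lt_i i).
  - by split=> //; right.
have ltUQ i u v : U i u -> Q i v -> u < v.
  move=> [Tu hu] [Tv v0 wv _]; case: hu => [->|wu].
    by rewrite lt_neqAle eq_sym v0 Tpos.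
  rewrite ltNge; apply/negP => vu.
  have := cw.2 _ _ Tv Tu vu; rewrite leNgt => /negP; apply.
  exact: lt_le_trans wv.
have cAQ i : ctrl q (Q i) A nu.
  exists (fun t => Nb%:R * (w t - i%:R / Nb%:R)); first split.
  - move=> t [_ _ w1 w2]; rewrite mulr_ge0 ?(ltW Nb0) ?subr_ge0 //=.
    rewrite mulrC -ler_pdivlMr // mul1r lerBlDr.
    by apply: ltW; apply: lt_le_trans w2 _; rewrite -addn1 natrD mulrDl mul1r addrC.
  - move=> u v [Tu _ _ _] [Tv _ _ _] uv; rewrite ler_wpM2l ?(ltW Nb0) //.
    by rewrite lerD2r; exact: cw.2.
  - move=> u v [Tu _ _ _] [Tv _ _ _] uv.
    apply: le_trans (bw _ _ Tu Tv uv) _.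
    have dw := control_diff cw Tu Tv uv.
    have -> : Nb%:R * (w v - i%:R / Nb%:R) - Nb%:R * (w u - i%:R / Nb%:R) =
      Nb%:R * (w v - w u) by ring.
    have e : w v - w u = Nb%:R^-1 * (Nb%:R * (w v - w u)).
      by rewrite mulrA mulVf ?mul1r // gt_eqF.
    have Nw : 0 <= Nb%:R * (w v - w u) by rewrite mulr_ge0 //; lra.
    rewrite {1}e (@powRM _ Nb%:R^-1 _ _ _ Nw) ?invr_ge0 // mulrA.
    by rewrite ler_wpM2r ?powR_ge0 // M_block.
have main i : ctrl p (U i) D (growth i * eps) /\ ctrl p (U i) kap (growth i * eps).
  elim: i => [|i [ihD ihk]].
    have U0 t : U 0%N t -> t = 0.
      move=> [Tt [//|]]; rewrite mul0r => /lt_geF.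
      by have /andP[-> _] := cw.1 _ Tt.
    by split; apply: ctrl_const => [|u v /U0 -> /U0 ->//]; rewrite /= mul0r.
  have gi := growth_ge0 i.
  have Vu0 : 0 <= growth i * eps by rewrite mulr_ge0 // ltW.
  have -> : growth i.+1 * eps = step_const * (eps + growth i * eps).
    by rewrite /growth iterS; ring.
  rewrite UQ; apply: block_step => //; rewrite -?UQ //.
  exact: ltUQ.
have UE : U Nb.+1 = `[0, T]%classic.
  apply/seteqP; split=> [t []//|t Tt]; split=> //; right.
  have /andP[_ w1] := cw.1 _ Tt; apply: le_lt_trans w1 _.
  by rewrite ltr_pdivlMr // mul1r ltr_nat.
by rewrite -UE; exact: main.
Qed.

End Data.
End Stability.

(** * Bounds for functions of class C^2_b *)

Section SmoothFunctions.
Context {R : realType}.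

Lemma delta_enorm_le1 m (i : 'I_m) : enorm (delta_mx 0 i : 'rV[R]_m) <= 1.
Proof.
rewrite /enorm (bigD1 i) //= big1 ?addr0 => [|j ji].
  by rewrite mxE !eqxx expr1n sqrtr1.
by rewrite mxE (negPf ji) andbF expr0n.
Qed.

(** The entries of a matrix are entries of the images of unit vectors. *)
Lemma opnorm_entry d n (H : 'M[R]_(d, n)) (c : R) i j :
  (opnorm H <= c%:E)%E -> `|H i j| <= c.
Proof.
move=> Hc; rewrite -lee_fin; apply: le_trans Hc.
apply: (@le_trans _ _ (enorm (delta_mx 0 i *m H))%:E).
  rewrite lee_fin -rowE; have <- : row i H 0 j = H i j by rewrite mxE.
  exact: le_trans (mx_norm_entry _ _ _) (mx_norm_le_enorm _).
apply: ereal_sup_ubound; exists (delta_mx 0 i) => //=; exact: delta_enorm_le1.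
Qed.

Lemma opnorm1_entry m d n (B : 'M[R]_(m, d * n)) (c : R) i k :
  (opnorm1 B <= c%:E)%E -> `|B i k| <= c.
Proof.
move=> Bc; case/mxvec_indexP: k => a b.
have -> : B i (mxvec_index a b) = vec_mx (delta_mx 0 i *m B) a b.
  by rewrite -rowE !mxE.
apply: opnorm_entry; apply: le_trans Bc.
apply: ereal_sup_ubound; exists (delta_mx 0 i) => //=; exact: delta_enorm_le1.
Qed.

Lemma opnorm2_entry m d n (B : 'M[R]_(m, m * (d * n))) (c : R) i k :
  (opnorm2 B <= c%:E)%E -> `|B i k| <= c.
Proof.
move=> Bc; case/mxvec_indexP: k => a b.
have -> : B i (mxvec_index a b) = vec_mx (delta_mx 0 i *m B) a b.
  by rewrite -rowE !mxE.
apply: opnorm1_entry; apply: le_trans Bc.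
apply: ereal_sup_ubound; exists (delta_mx 0 i) => //=; exact: delta_enorm_le1.
Qed.

Lemma opnorm_ge0 d n (H : 'M[R]_(d, n)) : (0 <= opnorm H)%E.
Proof.
apply: ereal_sup_ge; exists (enorm (0 *m H))%:E; last by rewrite lee_fin sqrtr_ge0.
exists 0 => //=; rewrite /enorm big1 ?sqrtr0 // => i _.
by rewrite mxE expr0n.
Qed.

Lemma enorm0_le1 m : enorm (0 : 'rV[R]_m) <= 1.
Proof. by rewrite /enorm big1 ?sqrtr0 // => i _; rewrite mxE expr0n. Qed.

Lemma opnorm1_ge0 m d n (B : 'M[R]_(m, d * n)) : (0 <= opnorm1 B)%E.
Proof.
apply: ereal_sup_ge; exists (opnorm (vec_mx (0 *m B))); last exact: opnorm_ge0.
by exists 0 => //=; exact: enorm0_le1.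
Qed.

Lemma opnorm2_ge0 m d n (B : 'M[R]_(m, m * (d * n))) : (0 <= opnorm2 B)%E.
Proof.
apply: ereal_sup_ge; exists (opnorm1 (vec_mx (0 *m B))); last exact: opnorm1_ge0.
by exists 0 => //=; exact: enorm0_le1.
Qed.

Lemma C2norm_bounds m d n (f : 'rV[R]_m -> 'M[R]_(d, n)) (c : R) :
  C2norm f = c%:E ->
  [/\ forall x, `|f x| <= c, forall x, `|Fderiv f x| <= c
    & forall x, `|Fderiv (Fderiv f) x| <= c].
Proof.
rewrite /C2norm; set a0 := ereal_sup _; set a1 := ereal_sup _; set a2 := ereal_sup _.
have p0 : (0 <= a0)%E.
  by apply: ereal_sup_ge; exists (opnorm (f 0)); [exists 0|exact: opnorm_ge0].
have p1 : (0 <= a1)%E.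
  by apply: ereal_sup_ge; exists (opnorm1 (Fderiv f 0)); [exists 0|exact: opnorm1_ge0].
have p2 : (0 <= a2)%E.
  by apply: ereal_sup_ge; exists (opnorm2 (Fderiv (Fderiv f) 0));
    [exists 0|exact: opnorm2_ge0].
move=> e.
have c0 : 0 <= c by rewrite -lee_fin -e !adde_ge0.
have h0 : (a0 <= c%:E)%E by rewrite -e -addeA leeDl // adde_ge0.
have h1 : (a1 <= c%:E)%E by rewrite -e addeAC leeDr // adde_ge0.
have h2 : (a2 <= c%:E)%E by rewrite -e leeDr // adde_ge0.
split=> x; apply: mx_norm_le => // i j.
- by apply: opnorm_entry; apply: le_trans h0; apply: ereal_sup_ubound; exists x.
- by apply: opnorm1_entry; apply: le_trans h1; apply: ereal_sup_ubound; exists x.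
- by apply: opnorm2_entry; apply: le_trans h2; apply: ereal_sup_ubound; exists x.
Qed.

(** The mean value theorem holds with equality one entry at a time; [t] depends on
    the entry. *)
Lemma mvt_entry m a b (F : 'rV[R]_m -> 'M[R]_(a, b)) x h i j :
  (forall z, differentiable F z) ->
  exists t, (F (x + h) - F x) i j = ('d F (x + t *: h) h) i j.
Proof.
move=> dF; pose g t := F (x + t *: h) i j.
have dg t : is_derive t (1 : R) g (('d F (x + t *: h) h) i j).
  have cF : (fun s => s^-1 *: (F (s *: h + (x + t *: h)) - F (x + t *: h))) @ 0^'
      --> 'd F (x + t *: h) h.
    by rewrite -deriveE //; apply: diff_derivable.
  have cg : (fun s : R => s^-1 *: (g (s *: (1 : R) + t) - g t : R^o)) @ 0^'
      --> ('d F (x + t *: h) h) i j.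
    have -> : (fun s : R => s^-1 *: (g (s *: (1 : R) + t) - g t : R^o)) =
        (fun M : 'M[R]_(a, b) => M i j) \o
        (fun s => s^-1 *: (F (s *: h + (x + t *: h)) - F (x + t *: h))).
      apply/funext => s /=; rewrite !mxE /g.
      have -> : s *: (1 : R) + t = s + t by rewrite [s *: _]mulr1.
      by rewrite scalerDl addrCA.
    exact: (cvg_comp _ _ cF (@coord_continuous R a b i j _)).
  apply: DeriveDef; first by apply/cvg_ex; eexists; exact: cg.
  exact: (cvg_lim _ cg).
have gc : {within `[0, 1], continuous g}.
  apply: continuous_subspaceT => t.
  by apply: differentiable_continuous; apply/derivable1_diffP; case: (dg t).
have [t _ ht] := MVT_segment (ler01 : (0 : R) <= 1) (fun t _ => dg t) gc.
exists t; rewrite subr0 mulr1 in ht; rewrite -ht /g scale1r scale0r addr0.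
by rewrite !mxE.
Qed.

Lemma Fderiv_lipschitz m a b (F : 'rV[R]_m -> 'M[R]_(a, b)) (c : R) x h :
  (forall z, differentiable F z) -> (forall z, `|Fderiv F z| <= c) ->
  `|F (x + h) - F x| <= m%:R * c * `|h|.
Proof.
move=> dF Fc.
have c0 : 0 <= c by apply: le_trans (Fc 0).
apply: mx_norm_le => [|i j]; first by rewrite !mulr_ge0.
have [t ->] := mvt_entry x h i j dF.
rewrite -FderivE mxE; apply: le_trans (mx_norm_entry _ _ _) _.
apply: le_trans (mx_norm_mul _ _) _.
by rewrite mulrAC; apply: ler_wpM2r => //; apply: ler_wpM2l.
Qed.

Lemma Fderiv_entry m a b (F : 'rV[R]_m -> 'M[R]_(a, b)) x i k l :
  Fderiv F x i (mxvec_index k l) = ('d F x (delta_mx 0 i)) k l.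
Proof. by rewrite -FderivE -rowE [RHS]mxE [RHS]mxE. Qed.

Lemma Fderiv_increment m a b (F : 'rV[R]_m -> 'M[R]_(a, b)) h x :
  (forall z, differentiable F z) ->
  differentiable (fun z => F (z + h) - F z) x /\
  Fderiv (fun z => F (z + h) - F z) x = Fderiv F (x + h) - Fderiv F x.
Proof.
move=> dF.
pose G z := F (z + h) - F z.
have dG : differentiable G x.
  have ds : differentiable (fun z : 'rV[R]_m => z + h) x.
    by apply: differentiableD.
  exact: differentiableB (differentiable_comp ds (dF _)) (dF x).
split; first exact: dG.
have e v : 'd G x v = 'd F (x + h) v - 'd F x v.
  have cF z : (fun s => s^-1 *: (F (s *: v + z) - F z)) @ 0^' --> 'd F z v.
    by rewrite -deriveE //; apply: diff_derivable.
  have cG : (fun s => s^-1 *: (G (s *: v + x) - G x)) @ 0^' --> 'd G x v.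
    by rewrite -deriveE //; apply: diff_derivable.
  have E : (fun s => s^-1 *: (G (s *: v + x) - G x)) =
      (fun s => s^-1 *: (F (s *: v + (x + h)) - F (x + h))
        - s^-1 *: (F (s *: v + x) - F x)).
    apply/funext => s; rewrite -scalerBr /G addrA; congr (_ *: _).
    by apply/matrixP => k l; rewrite !mxE; ring.
  have cB : (fun s => s^-1 *: (G (s *: v + x) - G x)) @ 0^' -->
      'd F (x + h) v - 'd F x v by rewrite E; exact: cvgB (cF (x + h)) (cF x).
  exact: (cvg_unique _ cG cB).
apply/matrixP => i k; case/mxvec_indexP: k => a' b'.
have -> : (Fderiv F (x + h) - Fderiv F x) i (mxvec_index a' b') =
    Fderiv F (x + h) i (mxvec_index a' b') - Fderiv F x i (mxvec_index a' b').
  by rewrite mxE [X in _ + X]mxE.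
have entryB (D1 D2 : 'M[R]_(a, b)) : (D1 - D2) a' b' = D1 a' b' - D2 a' b'.
  by rewrite mxE [X in _ + X]mxE.
have eF := congr2 (fun u v : R => u - v) (Fderiv_entry F (x + h) i a' b')
  (Fderiv_entry F x i a' b').
apply: etrans (Fderiv_entry G x i a' b') (etrans _ (esym eF)).
apply: etrans (congr1 (fun D : 'M[R]_(a, b) => D a' b') (e (delta_mx 0 i))) _.
exact: entryB.
Qed.

(** A C^2_b function satisfies the bounds with a multiple of its norm: apply the
    mean value inequality to f, to its derivative, and to the increment
    [x |-> f (x + h) - f x]. *)
Lemma Cb2_second_order_bound n d (f : 'rV[R]_n -> 'M[R]_(d, n)) (c : R) :
  Cb2 f -> C2norm f = c%:E ->
  second_order_bound ((1 + n%:R) ^+ 2 * c) f.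
Proof.
move=> [[df ddf] _ _ _ _] /C2norm_bounds[b0 b1 b2].
have c0 : 0 <= c by apply: le_trans (b0 0).
have n0 : 0 <= n%:R :> R by [].
have k1 : c <= (1 + n%:R) ^+ 2 * c.
  by rewrite ler_peMl // exprn_ege1 // lerDl.
have k2 : n%:R * c <= (1 + n%:R) ^+ 2 * c.
  rewrite ler_wpM2r // expr2; have := mulr_ge0 n0 n0; lra.
have k3 : n%:R * (n%:R * c) <= (1 + n%:R) ^+ 2 * c.
  rewrite mulrA ler_wpM2r // expr2; have := mulr_ge0 n0 n0; lra.
have lip x h : `|f (x + h) - f x| <= n%:R * c * `|h| by exact: Fderiv_lipschitz.
split=> [x|x y|x x' h].
- exact: le_trans k1.
- have := lip y (x - y); have -> : y + (x - y) = x by rewrite addrC subrK.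
  move=> /le_trans; apply.
  by rewrite ler_wpM2r.
have dG z := Fderiv_increment h z df.
have := @Fderiv_lipschitz n d n (fun z => f (z + h) - f z) (n%:R * c * `|h|)
  x' (x - x') (fun z => (dG z).1).
have -> : x' + (x - x') = x by rewrite addrC subrK.
move=> /(_ _)/le_trans; apply.
  by move=> z; rewrite (dG z).2; exact: Fderiv_lipschitz.
by rewrite ler_wpM2r // mulrA ler_wpM2r.
Qed.

End SmoothFunctions.

(** * Time changes and Young integrals *)

Section TimeChanges.
Context {R : realType}.
Variables (T : R) (lam : R -> R).
Hypotheses (T0 : 0 < T) (tc : time_change T lam).

Lemma time_change_in t : 0 <= t <= T -> 0 <= lam t <= T.
Proof.
case: tc => [[lf _ _] _] tT; have := lf t.
by rewrite /= !in_itv /=; apply.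
Qed.

Lemma time_change_onto t : 0 <= t <= T -> exists2 s, 0 <= s <= T & lam s = t.
Proof.
case: tc => [[_ _ ls] _] tT; have := ls t.
by rewrite /= in_itv /= => /(_ tT)[s]; rewrite /= in_itv /=; exists s.
Qed.

Lemma time_change_lt s t : 0 <= s <= T -> 0 <= t <= T -> s < t -> lam s < lam t.
Proof. by case: tc => _ lm sT tT; apply: lm; rewrite in_itv. Qed.

Lemma time_change_le s t : 0 <= s <= T -> 0 <= t <= T -> s <= t -> lam s <= lam t.
Proof.
move=> sT tT; rewrite le_eqVlt => /predU1P[->//|st].
exact: ltW (time_change_lt sT tT st).
Qed.

Lemma time_change_le_inv s t : 0 <= s <= T -> 0 <= t <= T ->
  lam s <= lam t -> s <= t.
Proof.
by move=> sT tT h; rewrite leNgt; apply/negP => /(time_change_lt tT sT); rewrite ltNge h.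
Qed.

Lemma time_change0 : lam 0 = 0.
Proof.
have z : 0 <= (0 : R) <= T by rewrite lexx ltW.
have [s sT s0] := time_change_onto z.
have /andP[l0 _] := time_change_in z; apply/eqP; rewrite eq_le l0 andbT.
by have /andP[s_ge0 _] := sT; have := time_change_le z sT s_ge0; rewrite s0.
Qed.

(** An increasing bijection is uniformly continuous: on the k-th level of height
    e / 2, a jump of size e would skip the whole level below it, whose preimage
    has positive length. *)
Lemma time_change_uniform e : 0 < e -> exists2 de, 0 < de &
  forall x y, 0 <= x <= T -> 0 <= y <= T -> y - x < de -> lam y - lam x < e.
Proof.
move=> e0; pose h := e / 2; have h0 : 0 < h by rewrite divr_gt0.
have eh : e = h + h by rewrite /h; field.
have key k : exists2 de, 0 < de & forall x y, 0 <= x <= T -> 0 <= y <= T ->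
    lam y <= k%:R * h -> y - x < de -> lam y - lam x < e.
  elim: k => [|k [de de0 ih]].
    exists 1 => // x y /time_change_in/andP[lx _] _; rewrite mul0r; lra.
  have [Tk|kT] := ltP T (k%:R * h).
    exists de => // x y xT yT _; apply: ih => //.
    by have /andP[_ ] := time_change_in yT; lra.
  case: k ih kT => [|k] ih kT.
    exists 1 => // x y /time_change_in/andP[lx _] _; rewrite mul1r; lra.
  have k0 : 0 <= k%:R * h by rewrite mulr_ge0 // ltW.
  have kS : k.+1%:R * h = k%:R * h + h by rewrite -addn1 natrD mulrDl mul1r.
  have [|c cT lc] := @time_change_onto (k.+1%:R * h); first lra.
  have [|c' c'T lc'] := @time_change_onto (k%:R * h); first lra.
  have cc' : c' < c.
    rewrite ltNge; apply/negP => /(time_change_le cT c'T); lra.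
  exists (Num.min de (c - c')); first by rewrite lt_min de0 subr_gt0.
  move=> x y xT yT ly; rewrite lt_min => /andP[d1 d2].
  have [lyk|lyk] := leP (lam y) (k.+1%:R * h); first exact: ih.
  have cy : c <= y by apply: time_change_le_inv => //; lra.
  rewrite ltNge; apply/negP => jump.
  have kSS : k.+2%:R * h = k.+1%:R * h + h by rewrite -addn1 natrD mulrDl mul1r.
  have : x <= c' by apply: time_change_le_inv => //; lra.
  lra.
have [de de0 hde] := key (Num.truncn (T / h)).+1.
exists de => // x y xT yT; apply: hde => //.
have /andP[_ lT] := time_change_in yT.
by apply: le_trans lT _; rewrite -ler_pdivrMr //; apply: ltW (truncnS_gt _).
Qed.

End TimeChanges.

Section YoungIntegrals.
Context {R : realType}.
Implicit Types (a b e : R).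

(** Convergence of the Riemann sums with an explicit mesh, which is easier to
    restrict and to compose than the filter. *)
Definition young_limit d n (H : R -> 'M[R]_(d, n)) (A : R -> 'rV[R]_d) a b
    (I : 'rV[R]_n) : Prop :=
  forall e, 0 < e -> exists2 de, 0 < de & forall s, itv_partition a b s ->
    mesh a s < de ->
    `|I - partition_sum (fun u v => (A v - A u) *m H u) a s| < e.

Lemma is_young_integral_limit d n (H : R -> 'M[R]_(d, n)) A a b I :
  is_young_integral H A a b I -> young_limit H A a b I.
Proof.
move=> h e e0; have := h _ (nbhsx_ballx I e e0).
case=> de /= de0 hde; exists de => // s ps ms; have := hde s (conj ps ms).
by rewrite /= -ball_normE.
Qed.

Lemma young_limit_refl d n (H : R -> 'M[R]_(d, n)) A a I :
  young_limit H A a a I -> I = 0.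
Proof.
move=> h; apply/eqP; rewrite -normr_le0; apply/ler_addgt0Pr => e e0.
have [de de0 hde] := h e e0; rewrite add0r.
have p : itv_partition a a [::] by [].
have m : mesh a [::] < de by rewrite mesh_lt.
by have := hde _ p m; rewrite partition_sum_nil subr0 => /ltW.
Qed.

(** A fine partition of [a, b], kept fixed, extends every fine partition of [b, c]
    to one of [a, c]. *)
Lemma young_limit_sub d n (H : R -> 'M[R]_(d, n)) A a b c I1 I2 :
  a <= b -> young_limit H A a b I1 -> young_limit H A a c I2 ->
  young_limit H A b c (I2 - I1).
Proof.
move=> ab h1 h2 e e0; have e2 : 0 < e / 2 by rewrite divr_gt0.
have [d1 d10 hd1] := h1 _ e2; have [d2 d20 hd2] := h2 _ e2.
have dm : 0 < Num.min d1 d2 by rewrite lt_min d10.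
have [s1 [p1 m1]] := exists_partition ab dm.
move: m1; rewrite lt_min => /andP[m11 m12].
exists d2 => // s2 p2 m2.
have l1 : last a s1 = b by case: p1 => _ /eqP.
have := hd2 _ (itv_partition_cat p1 p2); rewrite mesh_cat // m12 l1 m2 => /(_ isT).
rewrite partition_sum_cat l1 => k2.
have k1 := hd1 _ p1 m11.
set P1 := partition_sum _ a s1 in k1 k2; set P2 := partition_sum _ b s2 in k2 *.
have -> : I2 - I1 - P2 = (I2 - (P1 + P2)) - (I1 - P1).
  by apply/rowP => i; rewrite !mxE; ring.
by apply: le_lt_trans (ler_normB _ _) _; lra.
Qed.

Lemma partition_sum_map (V : nmodType) (g : R -> R -> V) (lam : R -> R) a s :
  partition_sum (fun u v => g (lam u) (lam v)) a s =
  partition_sum g (lam a) (map lam s).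
Proof.
by elim: s a => [|x s ih] a /=; rewrite ?partition_sum_nil // !partition_sum_cons ih.
Qed.

Lemma young_limit_time_change d n (H : R -> 'M[R]_(d, n)) A T lam u v I :
  time_change T lam -> 0 <= u -> v <= T ->
  young_limit H A (lam u) (lam v) I ->
  young_limit (H \o lam) (A \o lam) u v I.
Proof.
move=> tc u0 vT h e e0; have [de de0 hde] := h e e0.
have [de' de'0 hde'] := time_change_uniform tc de0.
exists de' => // s [ps /eqP ls] ms.
have sT t : t \in u :: s -> 0 <= t <= T.
  move=> /(path_lt_mem ps)/andP[ut]; rewrite ls => tv.
  by rewrite (le_trans u0 ut) (le_trans tv).
rewrite [X in I - X](partition_sum_map (fun u v => (A v - A u) *m H u)).
have image r a : path <%R a r -> path (fun x y => y - x < de') a r ->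
    (forall t, t \in a :: r -> 0 <= t <= T) -> path <%R (lam a) (map lam r) /\
    path (fun x y => y - x < de) (lam a) (map lam r).
  elim: r a => //= x r ih a /andP[ax pr] /andP[xa mr] rT.
  have [|p1 p2] := ih x pr mr; first by move=> t tr; apply: rT; rewrite inE tr orbT.
  have aT : 0 <= a <= T by apply: rT; rewrite inE eqxx.
  have xT : 0 <= x <= T by apply: rT; rewrite !inE eqxx orbT.
  by rewrite p1 p2 !andbT; split; [exact: (time_change_lt tc)|exact: hde'].
rewrite mesh_lt // in ms; have [pl ml] := image _ _ ps ms sT.
apply: hde; last by rewrite mesh_lt.
by split=> //; rewrite last_map ls.
Qed.

(** Two Young integrals are approximated along a common partition, where their
    difference splits as in f(Y) dA - f(Y') dA' =
    (f(Y) - f(Y')) dA + f(Y') d(A - A'). *)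
Lemma young_limit_difference d n (H H' : R -> 'M[R]_(d, n)) A A' a b I I' e :
  a <= b -> young_limit H A a b I -> young_limit H' A' a b I' -> 0 < e ->
  exists2 s, itv_partition a b s & `|(I - I') - partition_sum (fun u v =>
    (A v - A u) *m (H u - H' u) + ((A v - A' v) - (A u - A' u)) *m H' u) a s| <= e.
Proof.
move=> ab h1 h2 e0; have e2 : 0 < e / 2 by rewrite divr_gt0.
have [d1 d10 hd1] := h1 _ e2; have [d2 d20 hd2] := h2 _ e2.
have dm : 0 < Num.min d1 d2 by rewrite lt_min d10.
have [s [ps ms]] := exists_partition ab dm; exists s => //.
move: ms; rewrite lt_min => /andP[m1 m2].
have k1 := hd1 _ ps m1; have k2 := hd2 _ ps m2.
have -> : partition_sum (fun u v =>
    (A v - A u) *m (H u - H' u) + ((A v - A' v) - (A u - A' u)) *m H' u) a s =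
    partition_sum (fun u v => (A v - A u) *m H u) a s -
    partition_sum (fun u v => (A' v - A' u) *m H' u) a s.
  rewrite -partition_sumB; apply: eq_bigr => i _.
  rewrite !mulmxBr !mulmxBl.
  move: (_ *m H _) (_ *m H _) => c1 c2; apply/rowP => j; rewrite !mxE; ring.
set P1 := partition_sum _ a s in k1 *; set P2 := partition_sum _ a s in k2 *.
have -> : I - I' - (P1 - P2) = (I - P1) - (I' - P2).
  by apply/rowP => i; rewrite !mxE; ring.
by apply: le_trans (ler_normB _ _) _; apply: ltW; lra.
Qed.

End YoungIntegrals.

(** * The support of the reflection measure *)

Section StieltjesReflection.
Context {R : realType}.

Lemma stieltjes_itv (G : cumulative R R) (a b : R) : a <= b ->
  lebesgue_stieltjes_measure G `]a, b]%classic = (G b - G a)%:E.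
Proof.
move=> ab; rewrite /lebesgue_stieltjes_measure /measure_extension /=.
rewrite measurable_mu_extE /=; last exact: is_ocitv.
by rewrite wlength_itv_bnd.
Qed.

(** A right-continuous function is the limit of its values at the next point of
    a grid. *)
Lemma right_continuous_measurable (g : R -> R) (v : R) :
  (forall t : R, 0 < t < v -> g @ t^'+ --> g t) ->
  measurable_fun (`]0, v]%classic : set R) g.
Proof.
move=> rc.
pose h (n : nat) (s : R) : R := (Num.truncn (s * n.+1%:R)).+1%:R / n.+1%:R.
have n0 n : 0 < n.+1%:R :> R by rewrite ltr0n.
have hgt n s : s < h n s by rewrite /h ltr_pdivlMr // truncnS_gt.
have hle n s : 0 < s -> h n s <= s + n.+1%:R^-1.
  move=> s0; rewrite /h ler_pdivrMr // mulrDl mulVf ?gt_eqF // -addn1 natrD.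
  by rewrite lerD2r truncn_le // mulr_ge0 // ltW.
apply: (@measurable_fun_cvg _ _ _ _ (fun n s => g (Num.min v (h n s)))).
  move=> n.
  pose cell (k : nat) : set R := `[k%:R / n.+1%:R, k.+1%:R / n.+1%:R[%classic.
  have mcell k : measurable (cell k) by exact: measurable_itv.
  apply: (@measurable_funS _ _ _ _ (\bigcup_k cell k)).
  - exact: bigcup_measurable.
  - move=> s /=; rewrite in_itv /= => /andP[s0 _].
    exists (Num.truncn (s * n.+1%:R)) => //.
    rewrite /cell /= in_itv /= ler_pdivrMr // ltr_pdivlMr // truncnS_gt andbT.
    by rewrite truncn_le // mulr_ge0 // ltW.
  apply/measurable_fun_bigcup => // k.
  apply: (@eq_measurable_fun _ _ _ _ (cell k) (fun=> g (Num.min v (k.+1%:R / n.+1%:R)))).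
    move=> s; rewrite inE /cell /= in_itv /= ler_pdivrMr // ltr_pdivlMr // => ks.
    by rewrite /h (truncn_def ks).
  exact: measurable_cst.
move=> s /=; rewrite in_itv /= => /andP[s0]; rewrite le_eqVlt => /predU1P[sv|sv].
  have E n : Num.min v (h n s) = s by rewrite sv min_l // -sv ltW.
  by under eq_fun do rewrite E; exact: cvg_cst.
have [+ _] := cvg_at_rightP g s (g s); apply; first by apply: rc; rewrite s0.
split=> [n|]; first by rewrite lt_min sv hgt.
apply: (@squeeze_cvgr _ _ _ _ (fun=> s) (fun n => s + n.+1%:R^-1)).
- near=> n; rewrite le_min (ltW sv) (ltW (hgt _ _)) /=.
  by rewrite ge_min hle ?orbT.
- exact: cvg_cst.
- by rewrite -[X in _ --> X]addr0; apply: cvgD; [exact: cvg_cst|exact: cvg_harmonic].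
Unshelve. all: by end_near. Qed.

(** Where g does not vanish, the measure dk is null. Hence, if g had no zero in
    the part of ]u, v] where k exceeds a level c < k v, that part would be null,
    and the remaining part, where k is at most c, would carry the whole increment
    of k. *)
Lemma stieltjes_touching T (k g : R -> R) u v c :
  (forall s t, 0 <= s -> s <= t -> t <= T -> k s <= k t) ->
  (forall t : R, 0 < t < T -> g @ t^'+ --> g t) ->
  (forall t, 0 <= t <= T -> 0 <= g t) ->
  LS_integral_eq0 T k g ->
  0 <= u -> u <= v -> v <= T -> k u <= c -> c < k v ->
  exists s, [/\ u < s, s <= v, g s = 0 & c < k s].
Proof.
move=> km rc g0 [G kG intg] u0 uv vT uc cv.
apply: contrapT => none.
have Gk s : 0 <= s -> s <= T -> G s = k s.
  by move=> s0 sT; rewrite kG min_l // max_r.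
set mu := lebesgue_stieltjes_measure G.
have mg : measurable_fun (`]0, v]%classic : set R) (EFin \o g).
  apply/measurable_EFinP; apply: right_continuous_measurable => t /andP[t0 tv].
  by apply: rc; rewrite t0 (lt_le_trans tv).
have v0 : 0 <= v <= T by rewrite (le_trans u0 uv).
have [B [mB muB nB]] : mu.-negligible (`]0, v]%classic `&` [set s | g s != 0]).
  have absg : (\int[mu]_(x in `]0%R, v]) `|(EFin \o g) x| = 0)%E.
    rewrite -[RHS](intg v v0); apply: eq_integral => s; rewrite inE /= in_itv /=.
    move=> /andP[s0 sv]; rewrite ger0_norm // g0 // (ltW s0) /=.
    by rewrite (le_trans sv).
  have [B [mB muB hB]] := (ae_eq_integral_abs mu (measurable_itv `]0, v]) mg).1 absg.
  exists B; split=> // s [/= sv gs]; apply: hB => /= h.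
  by move: gs; have := h sv; rewrite /= => -[->]; rewrite eqxx.
have EB s : u < s -> s <= v -> c < k s -> B s.
  move=> us sv cs; apply: nB; split; first by rewrite /= in_itv /= (le_lt_trans u0).
  by apply/negP => /eqP gs; apply: none; exists s.
pose F : set R := `]u, v]%classic `\` B.
have mI a b : measurable (`]a, b]%classic : set R) by exact: measurable_itv.
have mF : measurable F by exact: measurableD.
have Fle s : F s -> k s <= c.
  move=> [/=]; rewrite in_itv /= => /andP[us sv] nBs; rewrite leNgt.
  by apply/negP => /(EB _ us sv).
have muF : ((k v - k u)%:E <= mu F)%E.
  rewrite -(Gk v) ?(le_trans u0) // -(Gk u) ?(le_trans uv) // -stieltjes_itv //.
  apply: (@le_trans _ _ (mu (F `|` B))).
    apply: le_measure; rewrite ?inE //; first exact: measurableU.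
    by move=> s us; have [Bs|nBs] := pselect (B s); [right|left].
  apply: (@le_trans _ _ (mu F + mu B)%E); first exact: measureU2.
  by rewrite [mu B]muB adde0.
have bound a : u <= a -> a <= v -> k a <= c -> (mu `]u, a]%classic <= (c - k u)%:E)%E.
  move=> ua av ac; rewrite [mu _]stieltjes_itv // lee_fin.
  have aT := le_trans av vT; have a0 := le_trans u0 ua.
  by rewrite (Gk a) // (Gk u) ?lerD2r // (le_trans ua).
suff : (mu F <= (c - k u)%:E)%E.
  by move=> /(le_trans muF); rewrite lee_fin lerD2r leNgt cv.
have [F0|/set0P Fn0] := eqVneq F set0.
  have -> : mu F = 0%E by rewrite F0; exact: measure0.
  by rewrite lee_fin subr_ge0.
have Fub : has_sup F.
  by split=> //; exists v => s [/=]; rewrite in_itv /= => /andP[].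
pose sig := sup F.
have Fsig s : F s -> s <= sig by move=> Fs; apply: ub_le_sup => //; case: Fub.
have [sigv usig] : sig <= v /\ u <= sig.
  have [s0 Fs0] := Fn0; split.
    by apply: ge_sup => // s [/=]; rewrite in_itv /= => /andP[].
  by apply: le_trans (Fsig _ Fs0); case: Fs0 => /=; rewrite in_itv /= => /andP[/ltW].
have [ksig|ksig] := leP (k sig) c.
  apply: le_trans (bound _ usig sigv ksig); apply: le_measure; rewrite ?inE //.
  move=> s Fs; rewrite /= in_itv /= (Fsig _ Fs) andbT.
  by case: Fs => /=; rewrite in_itv /= => /andP[].
have nFsig : ~ F sig by move=> /Fle; rewrite leNgt ksig.
pose a (n : nat) : R := Num.max u (sig - n.+1%:R^-1).
pose Fn n : set R := F `&` `]u, a n]%classic.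
have mFn n : measurable (Fn n) by exact: measurableI.
have FE : \bigcup_n Fn n = F.
  apply/seteqP; split=> [s [n _ []//]|s Fs].
  have ssig : s < sig.
    by rewrite lt_neqAle Fsig // andbT; apply: contra_notN nFsig => /eqP <-.
  exists (Num.truncn (sig - s)^-1) => //; split=> //.
  rewrite /= in_itv /= le_max; case: Fs => /=; rewrite in_itv /= => /andP[-> _] _ /=.
  apply/orP; right; rewrite lerBrDr addrC -lerBrDr.
  rewrite -[leRHS]invrK lef_pV2 ?posrE ?invr_gt0 ?subr_gt0 //.
  exact: ltW (truncnS_gt _).
have ndF : nondecreasing_seq Fn.
  move=> m n mn; apply/subsetPset => s [Fs sa]; split=> //.
  move: sa; rewrite /= !in_itv /= => /andP[-> /le_trans]; apply.
  rewrite /a le_max2 // lerD2l lerN2 lef_pV2 ?posrE // ler_nat.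
  by rewrite ltnS.
have mbig : measurable (\bigcup_n Fn n) by rewrite FE.
have cvF := nondecreasing_cvg_mu (mu := mu) mFn mbig ndF.
rewrite FE in cvF.
apply: (@le_trans _ _ (limn (mu \o Fn))).
  by rewrite (cvg_lim _ cvF) //; exact: ereal_hausdorff.
apply: lime_le; first by apply/cvg_ex; exists (mu F).
apply: nearW => n /=.
have [s Fs as_] : exists2 s, F s & sig - n.+1%:R^-1 < s.
  by apply: sup_adherent => //; rewrite invr_gt0.
have [us sv] : u < s /\ s <= v.
  by case: Fs => /=; rewrite in_itv /= => /andP[].
have as' : a n <= s by rewrite /a ge_max (ltW us) ltW.
have ua : u <= a n by rewrite /a le_max lexx.
have kan : k (a n) <= c.
  apply: le_trans (Fle _ Fs); apply: km => //; first exact: le_trans ua.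
  exact: le_trans vT.
apply: le_trans (bound _ ua (le_trans as' sv) kan).
apply: le_measure; [rewrite inE; exact: mFn|rewrite inE; exact: mI|].
by move=> r [].
Qed.

End StieltjesReflection.

(** * From p-variation norms to controls and back *)

Section VariationNorms.
Context {R : realType}.
Implicit Types (r T V : R).

Lemma initial_segment_itv T : 0 < T -> initial_segment (`[0, T]%classic : set R).
Proof.
move=> T0; split; first by rewrite /= in_itv /= lexx ltW.
  by move=> t /=; rewrite in_itv /= => /andP[].
move=> s t /=; rewrite !in_itv /= => /andP[_ tT] /andP[-> st].
exact: le_trans tT.
Qed.

Lemma pvar_le_sum m r T (Z : R -> 'rV[R]_m) V s : 0 < r ->
  (pvar r 0 T Z <= V%:E)%E -> itv_partition 0 T s ->
  partition_sum (fun u v => enorm (Z v - Z u) `^ r) 0 s <= V `^ r.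
Proof.
move=> r0; rewrite /pvar; set S := ereal_sup _ => SV ps.
set x := partition_sum _ _ _.
have x0 : 0 <= x by apply: sumr_ge0 => i _; exact: powR_ge0.
have xS : (x%:E <= S)%E by apply: ereal_sup_ubound; exists s.
have rn0 : r != 0 by rewrite gt_eqF.
have : S != +oo%E.
  by apply: contra_leN SV => /eqP ->; rewrite poweRyr ?invr_eq0 // ltry.
case: S SV xS => [z|//|//] SV xz _; rewrite poweR_EFin lee_fin in SV.
rewrite lee_fin in xz; have z0 := le_trans x0 xz; apply: le_trans xz _.
rewrite -[leLHS](powRVK rn0 z0); apply: powR_mono => //; first exact: ltW.
exact: powR_ge0.
Qed.

Lemma pvar_ctrl m r T (Z : R -> 'rV[R]_m) V : 1 <= r -> 0 < T -> 0 < V ->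
  (pvar r 0 T Z <= V%:E)%E -> ctrl r `[0, T] Z V.
Proof.
move=> r1 T0 V0 ZV; have r0 : 0 < r by rewrite (lt_le_trans _ r1).
apply: ctrl_of_sums => //; first exact: initial_segment_itv.
move=> t s; rewrite /= in_itv /= => /andP[t0 tT] [ps /eqP ls].
have sum_le (s' : seq R) : partition_sum (fun u v => `|Z v - Z u| `^ r) 0 s' <=
    partition_sum (fun u v => enorm (Z v - Z u) `^ r) 0 s'.
  apply: ler_sum => i _; apply: powR_mono; rewrite ?(ltW r0) //.
  exact: mx_norm_le_enorm.
move: tT; rewrite le_eqVlt => /predU1P[tT|tT].
  apply: le_trans (sum_le s) _; apply: (pvar_le_sum r0 ZV).
  by split; rewrite // ls tT.
apply: (@le_trans _ _ (partition_sum (fun u v => `|Z v - Z u| `^ r) 0 (rcons s T))).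
  rewrite -cats1 partition_sum_cat partition_sum_cons partition_sum_nil addr0.
  by rewrite lerDl powR_ge0.
apply: le_trans (sum_le _) _; apply: (pvar_le_sum r0 ZV).
by split; rewrite ?last_rcons // rcons_path ps ls.
Qed.

Lemma ctrl_pvar m r T (Z : R -> 'rV[R]_m) V : 1 <= r -> 0 < T -> 0 <= V ->
  ctrl r `[0, T] Z V -> (pvar r 0 T Z <= (m%:R * V)%:E)%E.
Proof.
move=> r1 T0 V0 [w cw wZ]; have r0 : 0 < r by rewrite (lt_le_trans _ r1).
have rn0 : r != 0 by rewrite gt_eqF.
have mV : 0 <= m%:R * V by rewrite mulr_ge0.
have sums s : itv_partition 0 T s ->
    partition_sum (fun u v => enorm (Z v - Z u) `^ r) 0 s <= (m%:R * V) `^ r.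
  move=> [ps /eqP ls].
  have sT x : x \in 0 :: s -> (`[0, T]%classic : set R) x.
    by move=> /(path_lt_mem ps); rewrite ls /= in_itv.
  have tele (a : R) l : path <%R a l ->
      (forall x, x \in a :: l -> (`[0, T]%classic : set R) x) ->
      partition_sum (fun u v => enorm (Z v - Z u) `^ r) a l <=
      (m%:R * V) `^ r * (w (last a l) - w a).
    elim: l a => [|x l ih] a /=; first by rewrite partition_sum_nil subrr mulr0.
    move=> /andP[ax pl] alT; rewrite partition_sum_cons.
    have Ta : (`[0, T]%classic : set R) a by apply: alT; rewrite inE eqxx.
    have Tx : (`[0, T]%classic : set R) x by apply: alT; rewrite !inE eqxx orbT.
    have {}ih : partition_sum (fun u v => enorm (Z v - Z u) `^ r) x l <=
        (m%:R * V) `^ r * (w (last x l) - w x).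
      by apply: ih => // z zl; apply: alT; rewrite inE zl orbT.
    have -> : w (last x l) - w a = (w x - w a) + (w (last x l) - w x) by ring.
    rewrite mulrDr; apply: lerD => //.
    have /andP[dw _] := control_diff cw Ta Tx (ltW ax).
    rewrite -[X in _ * X](powRVK rn0 dw) -powRM ?powR_ge0 //.
    apply: powR_mono; [exact: ltW|exact: sqrtr_ge0|].
    apply: le_trans (enorm_le_mx_norm _) _; rewrite -mulrA ler_wpM2l //.
    exact: wZ (ltW ax).
  apply: le_trans (tele _ _ ps sT) _; rewrite ler_piMr ?powR_ge0 // ls.
  have T00 : (`[0, T]%classic : set R) 0 by rewrite /= in_itv /= lexx ltW.
  have TT : (`[0, T]%classic : set R) T by rewrite /= in_itv /= lexx ltW.
  by have /andP[] := control_diff cw T00 TT (ltW T0).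
rewrite /pvar; set S := ereal_sup _.
have S0 : (0 <= S)%E.
  apply: ereal_sup_ge; exists (partition_sum (fun u v => enorm (Z v - Z u) `^ r) 0 [:: T])%:E.
    by exists [:: T] => //; exact: itv_partition1.
  by rewrite lee_fin; apply: sumr_ge0 => i _; exact: powR_ge0.
have SV : (S <= ((m%:R * V) `^ r)%:E)%E.
  by apply: ge_ereal_sup => _ [s ps <-]; rewrite lee_fin; exact: sums.
have : S \is a fin_num.
  by rewrite ge0_fin_numE //; apply: le_lt_trans SV (ltry _).
case: S S0 SV => // z z0 SV _; rewrite poweR_EFin lee_fin.
rewrite -[leRHS](powRKV rn0 mV); apply: powR_mono => //.
by rewrite invr_ge0 ltW.
Qed.

Lemma Dpath_ctrl m r T (Z : R -> 'rV[R]_m) : 1 <= r -> 0 < T -> Dpath r T Z ->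
  exists2 V, 0 <= V & ctrl r `[0, T] Z V.
Proof.
move=> r1 T0 [_ Zfin]; have Z0 : (0 <= pvar r 0 T Z)%E by exact: poweR_ge0.
have Zf : pvar r 0 T Z \is a fin_num by rewrite ge0_fin_numE.
have V0 : 0 < fine (pvar r 0 T Z) + 1 by rewrite ltr_wpDl // fine_ge0.
exists (fine (pvar r 0 T Z) + 1); first exact: ltW.
by apply: pvar_ctrl => //; rewrite EFinD fineK // leeDl.
Qed.

End VariationNorms.

(** * Reflected paths *)

Section ReflectedPaths.
Context {R : realType}.
Variables (n d : nat).
Implicit Types (T p q : R).

(** What the estimates retain of a reflected equation. Unlike the condition on
    the Stieltjes integral, this description is transported at once by a time
    change. As Y - K is the part of Y before reflection, the obstacle of K is
    L - (Y - K). *)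
Definition reflected_path (f : 'rV[R]_n -> 'M[R]_(d, n)) T (y : 'rV[R]_n)
    (A : R -> 'rV[R]_d) (X L Y K I : R -> 'rV[R]_n) : Prop :=
  [/\ I 0 = 0, forall t, 0 <= t <= T -> Y t = y + I t + X t + K t,
      forall u v, 0 <= u -> u <= v -> v <= T ->
        young_limit (f \o Y) A u v (I v - I u)
    & forall i, skorokhod `[0, T] (fun t => K t 0 i)
        (fun t => L t 0 i - (Y t 0 i - K t 0 i))].

Lemma cadlag_entry m T (Z : R -> 'rV[R]_m) i t : cadlag T Z -> 0 <= t < T ->
  (fun s => Z s 0 i) @ t^'+ --> Z t 0 i.
Proof.
move=> [rc _] tT.
exact: (cvg_comp _ _ (rc _ tT) (@coord_continuous R 1 m 0 i _)).
Qed.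

Lemma reflected_solution_path (f : 'rV[R]_n -> 'M[R]_(d, n)) p T y A X L Y K :
  0 < T -> Dpath p T L -> reflected_solution f p T y A X L Y K ->
  exists I, reflected_path f T y A X L Y K I.
Proof.
move=> T0 [cadL _] [[[cadY _] _] eqY LY KK].
exists (fun t => Y t - y - X t - K t).
have lim t : 0 <= t <= T -> young_limit (f \o Y) A 0 t (Y t - y - X t - K t).
  move=> tT; have [I hI ->] := eqY t tT.
  have -> : y + I + X t + K t - y - X t - K t = I.
    by apply/rowP => i; rewrite !mxE; ring.
  exact: is_young_integral_limit.
split.
- apply: (@young_limit_refl _ _ _ (f \o Y) A 0); apply: lim.
  by rewrite lexx ltW.
- by move=> t tT; apply/rowP => i; rewrite !mxE; ring.
- move=> u v u0 uv vT.
  have uT : 0 <= u <= T by rewrite u0 (le_trans uv).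
  have vT' : 0 <= v <= T by rewrite vT (le_trans u0).
  exact: young_limit_sub u0 (lim _ uT) (lim _ vT').
move=> i; have [Km K0 LSi] := KK i.
split=> //.
- move=> s t /=; rewrite !in_itv /= => /andP[s0 _] /andP[_ tT] st.
  exact: Km.
- by move=> t /=; rewrite in_itv /= => /(LY i); lra.
move=> u v e /=; rewrite !in_itv /= => /andP[u0 _] /andP[_ vT] uv Kuv e0.
have [||||s [us sv gs cs]] := @stieltjes_touching R T (fun t => K t 0 i)
    (fun t => Y t 0 i - L t 0 i) u v (Num.max (K u 0 i) (K v 0 i - e)) Km _ _ LSi u0 uv vT.
- move=> t /andP[t0 tT]; have tT' : 0 <= t < T by rewrite ltW.
  exact: cvgB (cadlag_entry (i := i) cadY tT') (cadlag_entry (i := i) cadL tT').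
- by move=> t /(LY i); rewrite subr_ge0.
- by rewrite le_max lexx.
- by rewrite gt_max Kuv /=; lra.
exists s; split=> //.
  by rewrite in_itv /= (le_trans sv vT) (le_trans u0) // ltW.
have : K v 0 i - e < K s 0 i by apply: le_lt_trans cs; rewrite le_max lexx orbT.
by move: gs; lra.
Qed.

Lemma reflected_path_time_change f T y A X L Y K I lam :
  0 < T -> time_change T lam -> reflected_path f T y A X L Y K I ->
  reflected_path f T y (A \o lam) (X \o lam) (L \o lam) (Y \o lam) (K \o lam)
    (I \o lam).
Proof.
move=> T0 tc [I0 eqY lim sk].
have lT := time_change_in tc; have l0 := time_change0 T0 tc.
split=> [|t tT|u v u0 uv vT|i].
- by rewrite /= l0.
- by rewrite /= eqY // lT.
- have uT : 0 <= u <= T by rewrite u0 (le_trans uv).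
  have vT' : 0 <= v <= T by rewrite vT (le_trans u0).
  apply: (young_limit_time_change (H := f \o Y) tc u0 vT).
  have /andP[lu _] := lT _ uT; have /andP[_ lv] := lT _ vT'.
  by apply: lim => //; exact: (time_change_le tc).
have [K0 Km NK Kmin] := sk i; split=> [|s t|t|u v e] /=.
- by rewrite l0.
- rewrite !in_itv /= => sT tT st; apply: Km; rewrite /= ?in_itv /= ?lT //.
  exact: (time_change_le tc).
- by rewrite in_itv /= => tT; apply: NK; rewrite /= in_itv /= lT.
rewrite !in_itv /= => uT vT uv Kuv e0.
have luT : (`[0, T]%classic : set R) (lam u) by rewrite /= in_itv /= lT.
have lvT : (`[0, T]%classic : set R) (lam v) by rewrite /= in_itv /= lT.
have [r [rT ur rv h]] := Kmin _ _ e luT lvT (time_change_le tc uT vT uv) Kuv e0.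
move: rT; rewrite /= in_itv /= => rT.
have [s sT sr] := time_change_onto tc rT; exists s; rewrite in_itv /= sr.
split=> //.
  by rewrite ltNge; apply/negP => /(time_change_le tc sT uT); rewrite sr leNgt ur.
by apply: (time_change_le_inv tc sT vT); rewrite sr.
Qed.

(** A constant path above a constant obstacle is not reflected. *)
Lemma reflected_path_const f T (y x l : 'rV[R]_n) :
  (forall i, l 0 i <= (y + x) 0 i) ->
  reflected_path f T y (fun=> 0) (fun=> x) (fun=> l) (fun=> y + x) (fun=> 0)
    (fun=> 0).
Proof.
move=> lyx; split=> [//|t _|u v u0 uv vT e e0|i].
- by rewrite !addr0.
- exists 1 => // s _ _; rewrite /partition_sum big1 ?subrr ?subr0 ?normr0 //.
  by move=> j _; rewrite mul0mx.
split=> [|s t _ _ _|t _|u v e _ _ _]; rewrite ?mxE //.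
  by have := lyx i; rewrite mxE; lra.
by rewrite ltxx.
Qed.

Section TwoPaths.
Variables (p q b M V' : R).
Hypotheses (q1 : 1 <= q) (qp : q <= p) (pq : 1 < p^-1 + q^-1).
Hypotheses (b0 : 0 <= b) (M0 : 0 <= M) (V'0 : 0 <= V').

Definition stability_const : R :=
  growth n d p q b M V' (block_count n d p q b M V').+1.

Lemma reflected_path_stability T eps f y y' A A' X X' L L' Y Y' K K' I I' :
  0 < T -> 0 < eps -> second_order_bound b f ->
  reflected_path f T y A X L Y K I -> reflected_path f T y' A' X' L' Y' K' I' ->
  X 0 = X' 0 -> `|y - y'| <= eps -> `|L 0 - L' 0| <= eps ->
  ctrl q `[0, T] A M -> ctrl q `[0, T] (fun t => A t - A' t) eps ->
  ctrl p `[0, T] (fun t => X t - X' t) eps ->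
  ctrl p `[0, T] (fun t => L t - L' t) eps ->
  ctrl p `[0, T] Y' V' ->
  (exists2 V, 0 <= V & ctrl p `[0, T] (fun t => Y t - Y' t) V) ->
  ctrl p `[0, T] (fun t => Y t - Y' t) (stability_const * eps) /\
  ctrl p `[0, T] (fun t => K t - K' t) (stability_const * eps).
Proof.
move=> T0 e0 fb [I0 eqY lim sk] [I'0 eqY' lim' sk'] X0 ye Le cA cAA cXX cLL cY' cD.
apply: (stability_by_blocks q1 qp pq b0 M0 V'0 T0 e0 fb eqY eqY' I0 I'0 X0 _ sk sk'
  ye Le cA cAA cXX cLL cY' cD).
move=> u v e u0 uv vT ep.
have [s ps hs] := young_limit_difference uv (lim u v u0 uv vT) (lim' u v u0 uv vT) ep.
exists s => //; apply: le_trans hs.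
have -> : I v - I' v - (I u - I' u) = I v - I u - (I' v - I' u).
  by apply/rowP => i; rewrite !mxE; ring.
by [].
Qed.

Lemma stability_const_ge0 : 0 <= stability_const.
Proof. exact: growth_ge0. Qed.

End TwoPaths.

(** Comparing a reflected path with a constant one bounds its variation: this is
    the stability estimate again, where the second path has no variation. *)
Lemma reflected_path_variation p q b M T f y A X L Y K I :
  1 <= q -> q <= p -> 1 < p^-1 + q^-1 -> 0 <= b -> 0 < M ->
  0 < T -> second_order_bound b f -> reflected_path f T y A X L Y K I ->
  (forall i, L 0 0 i <= Y 0 0 i) ->
  ctrl q `[0, T] A M -> ctrl p `[0, T] X M -> ctrl p `[0, T] L M ->
  (exists2 V, 0 <= V & ctrl p `[0, T] Y V) ->
  ctrl p `[0, T] Y (stability_const p q b M 0 * M).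
Proof.
move=> q1 qp pq b0 M0 T0 fb rY LY cA cX cL [V Vp cY].
have p1 : 1 <= p by exact: le_trans qp.
have shift r (m : nat) (Z : R -> 'rV[R]_m) z c : 0 <= c -> ctrl r `[0, T] Z c ->
    ctrl r `[0, T] (fun t => Z t - z) c.
  move=> c0; rewrite -[X in ctrl _ _ (fun t => _ - z) X]mul1r.
  by apply: ctrl_dom => // u v _ _ _; rewrite mul1r opprB addrA subrK.
have unshift (Z : R -> 'rV[R]_n) z c : 0 <= c -> ctrl p `[0, T] (fun t => Z t - z) c ->
    ctrl p `[0, T] Z c.
  move=> c0; rewrite -[X in ctrl _ _ Z X]mul1r.
  by apply: ctrl_dom => // u v _ _ _; rewrite mul1r opprB addrA subrK.
have Y0 : Y 0 = y + X 0.
  have [I0 eqY _ sk] := rY; rewrite eqY ?lexx ?ltW // I0 addr0.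
  suff -> : K 0 = 0 by rewrite addr0.
  by apply/rowP => i; have [-> _ _ _] := sk i; rewrite mxE.
have rc : reflected_path f T y (fun=> 0) (fun=> X 0) (fun=> L 0) (fun=> y + X 0)
    (fun=> 0) (fun=> 0).
  by apply: reflected_path_const => i; rewrite -Y0.
have M0' := ltW M0.
apply: (unshift _ (y + X 0)).
  by rewrite mulr_ge0 // stability_const_ge0.
have [] // := reflected_path_stability q1 qp pq b0 M0' (lexx 0) T0 M0 fb rY rc.
- by rewrite subrr normr0.
- by rewrite subrr normr0.
- exact: shift.
- exact: shift.
- exact: shift.
- exact: ctrl_const.
by exists V => //; exact: shift.
Qed.

End ReflectedPaths.

(** * The Skorokhod J1 estimate *)

Theorem corollary2p10 (R : realType) (n d : nat) (p q M normf : R) :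
  (1 <= n)%N -> (1 <= d)%N ->
  1 <= q -> q < 2 -> q <= p -> 1 < p^-1 + q^-1 -> 0 < M ->
  exists2 C : R, 0 < C &
  forall (T : R) (f : 'rV[R]_n -> 'M[R]_(d, n))
    (y y' : 'rV[R]_n) (A A' : R -> 'rV[R]_d) (X X' L L' : R -> 'rV[R]_n)
    (Y K Y' K' : R -> 'rV[R]_n),
  0 < T ->
  Cb2 f -> C2norm f = normf%:E ->
  Dpath q T A -> Dpath q T A' ->
  Dpath p T X -> Dpath p T X' ->
  Dpath p T L -> Dpath p T L' ->
  (* sigma_hat only sees increments, while the solution starts at y + X 0. *)
  X 0 = X' 0 ->
  (forall i, L 0 0 i <= y 0 i) -> (forall i, L' 0 0 i <= y' 0 i) ->
  reflected_solution f p T y A X L Y K ->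
  reflected_solution f p T y' A' X' L' Y' K' ->
  (pvar q 0 T A <= M%:E)%E -> (pvar q 0 T A' <= M%:E)%E ->
  (pvar p 0 T X <= M%:E)%E -> (pvar p 0 T X' <= M%:E)%E ->
  (pvar p 0 T L <= M%:E)%E -> (pvar p 0 T L' <= M%:E)%E ->
  (sigma p T Y K Y' K' <=
    C%:E * ((enorm (y - y'))%:E + (enorm (L 0 - L' 0))%:E
            + sigma_hat p q T A X L A' X' L'))%E.
Proof.
move=> _ _ q1 _ qp pq M0.
have p1 : 1 <= p by exact: le_trans qp.
have M0' := ltW M0.
pose b : R := (1 + n%:R) ^+ 2 * `|normf|.
have b0 : 0 <= b by rewrite mulr_ge0 // sqr_ge0.
pose V' := stability_const n d p q b M 0 * M.
have V'0 : 0 <= V' by rewrite mulr_ge0 // stability_const_ge0.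
pose c := stability_const n d p q b M V'.
have c0 : 0 <= c by exact: stability_const_ge0.
have nc0 : 0 <= n%:R * c by rewrite mulr_ge0.
pose C := 2 * (n%:R * c) + 1.
have C0 : 0 < C by rewrite /C; lra.
exists C => // T f y y' A A' X X' L L' Y K Y' K' T0 Cf nf DA DA' DX DX' DL DL'
  X0 _ _ sol sol' MA MA' MX MX' ML ML'.
have fb : second_order_bound b f.
  have [fx _ _] := C2norm_bounds nf.
  have nf0 : 0 <= normf by apply: le_trans (fx 0).
  by rewrite /b ger0_norm //; exact: Cb2_second_order_bound.
have [I rI] := reflected_solution_path T0 DL sol.
have [I' rI'] := reflected_solution_path T0 DL' sol'.
have [[DY DK] _ _ _] := sol; have [[DY' DK'] _ LY' _] := sol'.
have cY' : ctrl p `[0, T] Y' V'.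
  apply: (reflected_path_variation q1 qp pq b0 M0 T0 fb rI').
  - by move=> i; apply: LY'; rewrite lexx ltW.
  - exact: pvar_ctrl.
  - exact: pvar_ctrl.
  - exact: pvar_ctrl.
  - exact: Dpath_ctrl.
set e1 := enorm (y - y'); set e2 := enorm (L 0 - L' 0).
have e10 : 0 <= e1 by exact: sqrtr_ge0.
have e20 : 0 <= e2 by exact: sqrtr_ge0.
(* The infimum need not be attained, but some time change brings the data within
   any [x] above it; such an [x] is positive, as the absorption argument requires. *)
have key x : 0 < x -> (sigma_hat p q T A X L A' X' L' < x%:E)%E ->
    (sigma p T Y K Y' K' <= (C * (e1 + e2 + x))%:E)%E.
  move=> x0 /ereal_inf_lt[_ [lam tc <-]]; rewrite gt_max => /andP[lamx sumx].
  have pv0 r m (Z : R -> 'rV[R]_m) : (0 <= pvar r 0 T Z)%E by exact: poweR_ge0.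
  set eps := e1 + e2 + x.
  have eps0 : 0 < eps by rewrite ltr_wpDl // addr_ge0.
  have xe : x <= eps by rewrite lerDr addr_ge0.
  have sume : (pvar q 0 T (A \o lam \- A')%R + pvar p 0 T (X \o lam \- X')%R
     + pvar p 0 T (L \o lam \- L')%R <= eps%:E)%E.
    by apply: le_trans (ltW sumx) _; rewrite lee_fin.
  have cAA : ctrl q `[0, T] (fun t => (A \o lam) t - A' t) eps.
    apply: pvar_ctrl => //; apply: le_trans sume.
    by rewrite -addeA leeDl // adde_ge0.
  have cXX : ctrl p `[0, T] (fun t => (X \o lam) t - X' t) eps.
    apply: pvar_ctrl => //; apply: le_trans sume.
    by rewrite addeAC leeDr // adde_ge0.
  have cLL : ctrl p `[0, T] (fun t => (L \o lam) t - L' t) eps.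
    apply: pvar_ctrl => //; apply: le_trans sume.
    by rewrite leeDr // adde_ge0.
  have l0 := time_change0 T0 tc.
  have lamT t : (`[0, T]%classic : set R) t -> (`[0, T]%classic : set R) (lam t).
    by rewrite /= !in_itv /=; exact: time_change_in.
  have lamle u v : (`[0, T]%classic : set R) u -> (`[0, T]%classic : set R) v ->
      u <= v -> lam u <= lam v.
    by rewrite /= !in_itv /=; exact: time_change_le.
  have cAl : ctrl q `[0, T] (A \o lam) M.
    by apply: ctrl_comp lamT lamle _; exact: pvar_ctrl.
  have cD : exists2 V, 0 <= V & ctrl p `[0, T] (fun t => (Y \o lam) t - Y' t) V.
    have [V V0 cY] := Dpath_ctrl p1 T0 DY.
    exists (2 * (1 * V + 1 * V')); first lra.
    apply: ctrl_dom2 (ctrl_comp lamT lamle cY) cY' => // u v _ _ _; rewrite !mul1r.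
    have -> : (Y \o lam) v - Y' v - ((Y \o lam) u - Y' u) =
      ((Y \o lam) v - (Y \o lam) u) - (Y' v - Y' u).
      by apply/rowP => i; rewrite !mxE; ring.
    exact: ler_normB.
  have rlam := reflected_path_time_change T0 tc rI.
  have [|||cY cK] := reflected_path_stability q1 qp pq b0 M0' V'0 T0 eps0 fb rlam rI'
    _ _ _ cAl cAA cXX cLL cY' cD.
  - by rewrite /= l0.
  - by apply: le_trans (mx_norm_le_enorm _) _; rewrite -/e1 /eps; lra.
  - by rewrite /= l0; apply: le_trans (mx_norm_le_enorm _) _; rewrite -/e2 /eps; lra.
  have ce0 : 0 <= c * eps by rewrite mulr_ge0 // ltW.
  apply: ge_ereal_inf; eexists; first by exists lam.
  rewrite ge_max; apply/andP; split.
    apply: le_trans (ltW lamx) _; rewrite lee_fin; apply: le_trans xe _.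
    by rewrite ler_peMl ?(ltW eps0) // /C; lra.
  apply: (@le_trans _ _ ((n%:R * (c * eps))%:E + (n%:R * (c * eps))%:E)%E).
    by apply: leeD; exact: ctrl_pvar.
  rewrite -EFinD lee_fin /C mulrDl mul1r mulrA.
  have : 0 <= n%:R * c * eps by rewrite mulr_ge0 // ltW.
  lra.
have sh0 : (0 <= sigma_hat p q T A X L A' X' L')%E.
  apply: le_ereal_inf_tmp => _ [lam _ <-].
  by rewrite le_max !adde_ge0 ?poweR_ge0 ?orbT.
have [shy|shf] := eqVneq (sigma_hat p q T A X L A' X' L') +oo%E.
  by rewrite shy addey // gt0_muley // leey.
have fin : sigma_hat p q T A X L A' X' L' \is a fin_num.
  by rewrite ge0_fin_numE // lt_neqAle shf leey.
apply/lee_addgt0Pr => e ep.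
have eC : 0 < e / C by rewrite divr_gt0.
case: (sigma_hat _ _ _ _ _ _ _ _ _) key fin sh0 {shf} => // s key _ s0.
rewrite lee_fin in s0.
apply: le_trans (key (s + e / C) _ _) _; first lra.
  by rewrite lte_fin; lra.
change ((C * (e1 + e2 + (s + e / C)))%:E <= (C * (e1 + e2 + s) + e)%:E)%E.
rewrite lee_fin.
have -> : C * (e1 + e2 + (s + e / C)) = C * (e1 + e2 + s) + e * (C / C) by ring.
by rewrite divff ?mulr1 // gt_eqF.
Qed.
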